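(* Let $\epsilon,\mu>0$ be constants and $\eta=\sqrt{\mu/\epsilon}$. Suppose $F_h,F_e\in C^\infty(\mathbb{R}^3,\mathbb{R}^3)$ with $\nabla\cdot F_h=0$ and $\nabla\cdot F_e=0$, and write $F_1^{(n)}=(\nabla\times)^nF_h$, $F_2^{(n)}=(\nabla\times)^nF_e$ for $n\ge 0$. Suppose there exist constants $C>0$, $A>0$ and $0\le\beta<1$ such that $$\left|F_j^{(n)}(x,y,z)\right|\le C A^n (n!)^\beta,\qquad j=1,2,$$ for all sufficiently large $n$, uniformly in $(x,y,z)\in\mathbb{R}^3$. Then the series in $$H(x,y,z,\theta)=F_h(x,y,z)+\sum_{n=0}^{\infty}(-1)^{n+1}\frac{\theta^{2(n+1)}}{(2(n+1))!}F_1^{(2(n+1))}(x,y,z)+\frac1\eta\sum_{n=0}^{\infty}(-1)^{n+1}\frac{\theta^{2n+1}}{(2n+1)!}F_2^{(2n+1)}(x,y,z),$$ $$E(x,y,z,\theta)=F_e(x,y,z)+\sum_{n=0}^{\infty}(-1)^{n+1}\frac{\theta^{2(n+1)}}{(2(n+1))!}F_2^{(2(n+1))}(x,y,z)+\eta\sum_{n=0}^{\infty}(-1)^{n}\frac{\theta^{2n+1}}{(2n+1)!}F_1^{(2n+1)}(x,y,z)$$ converge absolutely and uniformly on compact $\theta$-intervals, and the resulting fields $H,E$ satisfy the initial-value problem (source-free Maxwell equations with initial values $F_h,F_e$).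
   Context: For a vector field $F:\mathbb{R}^3\to\mathbb{R}^3$ the repeated curl is defined by $(\nabla\times)^0F=F$ and $(\nabla\times)^nF=\nabla\times\left((\nabla\times)^{n-1}F\right)$ for $n\ge1$; all curls act in the space variables $(x,y,z)$ only. The initial-value problem for fields $H,E:\mathbb{R}^4\to\mathbb{R}^3$ (functions of $(x,y,z,\theta)$, where $\theta=ct$ is rescaled time; the paper works with smooth fields) is $$\frac{\partial H}{\partial\theta}=-\frac1\eta\nabla\times E,\qquad \frac{\partial E}{\partial\theta}=\eta\,\nabla\times H,\qquad H(x,y,z,0)=F_h(x,y,z),\qquad E(x,y,z,0)=F_e(x,y,z).$$ *)

(* Defs.v *)
From Stdlib Require Import Reals List Arith.
From Coquelicot Require Import Coquelicot.
Import ListNotations.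
Open Scope R_scope.

(* The canonical product norm on R * R * R is the Euclidean one; see norm_R3. *)
Notation R3 := (R * R * R)%type.
Notation R4 := (R3 * R)%type.

Definition cx (v : R3) : R := fst (fst v).
Definition cy (v : R3) : R := snd (fst v).
Definition cz (v : R3) : R := snd v.

Definition e_x : R3 := (1, 0, 0).
Definition e_y : R3 := (0, 1, 0).
Definition e_z : R3 := (0, 0, 1).
Definition basis3 : list R3 := [e_x; e_y; e_z].
Definition basis4 : list R4 := [(e_x, 0); (e_y, 0); (e_z, 0); ((0, 0, 0), 1)].

Lemma norm_R3 (v : R3) : norm v = sqrt (cx v ^ 2 + cy v ^ 2 + cz v ^ 2).
Proof.
destruct v as [[x y] z]; unfold cx, cy, cz; simpl fst; simpl snd.
change (norm (x, y, z)) with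
  (sqrt (sqrt (Rabs x ^ 2 + Rabs y ^ 2) ^ 2 + Rabs z ^ 2)).
rewrite pow2_sqrt by (apply Rplus_le_le_0_compat; apply pow2_ge_0).
now rewrite !pow2_abs.
Qed.

Definition partial {V : NormedModule R_AbsRing} (e : V) (f : V -> R) (p : V) : R :=
  Derive (fun t => f (plus p (scal t e))) 0.

Definition ex_partial {V : NormedModule R_AbsRing} (e : V) (f : V -> R) (p : V)
  : Prop :=
  ex_derive (fun t => f (plus p (scal t e))) 0.

(* For B a basis of a finite-dimensional V this is the class C^k: continuity of
   the k-th order partial derivatives along B forces that of the lower-order
   ones. *)
Fixpoint class_C {V : NormedModule R_AbsRing} (B : list V) (k : nat) (f : V -> R)
  : Prop :=
  match k with
  | O => forall p, continuous f p
  | S k' => forall e, In e B ->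
      (forall p, ex_partial e f p) /\ class_C B k' (partial e f)
  end.

Definition smooth {V : NormedModule R_AbsRing} (B : list V) (F : V -> R3) : Prop :=
  forall k, class_C B k (fun p => cx (F p)) /\ class_C B k (fun p => cy (F p))
         /\ class_C B k (fun p => cz (F p)).

Definition divergence (F : R3 -> R3) (p : R3) : R :=
  partial e_x (fun q => cx (F q)) p + partial e_y (fun q => cy (F q)) p
  + partial e_z (fun q => cz (F q)) p.

Definition curl (F : R3 -> R3) (p : R3) : R3 :=
  (partial e_y (fun q => cz (F q)) p - partial e_z (fun q => cy (F q)) p,
   partial e_z (fun q => cx (F q)) p - partial e_x (fun q => cz (F q)) p,
   partial e_x (fun q => cy (F q)) p - partial e_y (fun q => cx (F q)) p).

Definition curl_iter (n : nat) (F : R3 -> R3) : R3 -> R3 := Nat.iter n curl F.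

Definition curl_term (s k : nat) (F : R3 -> R3) (p : R3) (theta : R) : R3 :=
  scal ((-1) ^ s * (theta ^ k / INR (fact k))) (curl_iter k F p).

Definition even_terms (F : R3 -> R3) (n : nat) : R3 -> R -> R3 :=
  curl_term (n + 1) (2 * (n + 1)) F.

Definition odd_terms_H (F : R3 -> R3) (n : nat) : R3 -> R -> R3 :=
  curl_term (n + 1) (2 * n + 1) F.

Definition odd_terms_E (F : R3 -> R3) (n : nat) : R3 -> R -> R3 :=
  curl_term n (2 * n + 1) F.

(* Series is total, so this is the sum only when the series converges. *)
Definition vsum (a : nat -> R3 -> R -> R3) (p : R3) (theta : R) : R3 :=
  (Series (fun n => cx (a n p theta)), Series (fun n => cy (a n p theta)),
   Series (fun n => cz (a n p theta))).

Definition field_H (eta : R) (Fh Fe : R3 -> R3) (q : R4) : R3 :=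
  let (p, theta) := q in
  plus (plus (Fh p) (vsum (even_terms Fh) p theta))
       (scal (1 / eta) (vsum (odd_terms_H Fe) p theta)).

Definition field_E (eta : R) (Fh Fe : R3 -> R3) (q : R4) : R3 :=
  let (p, theta) := q in
  plus (plus (Fe p) (vsum (even_terms Fe) p theta))
       (scal eta (vsum (odd_terms_E Fh) p theta)).

Definition converges_absolutely (a : nat -> R3 -> R -> R3) : Prop :=
  forall p theta, ex_series (fun n => norm (a n p theta)).

(* The rate is uniform over all of space as well as over the theta-interval. *)
Definition converges_uniformly_on_compacts (a : nat -> R3 -> R -> R3) : Prop :=
  forall t1 t2 eps : R, 0 < eps ->
  eventually (fun N => forall p theta, t1 <= theta <= t2 ->
    norm (minus (sum_n (fun n => a n p theta) N) (vsum a p theta)) < eps).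

Definition maxwell_ivp (eta : R) (Fh Fe : R3 -> R3) (H E : R4 -> R3) : Prop :=
  smooth basis4 H /\ smooth basis4 E /\
  (forall p theta,
     is_derive (fun t => H (p, t)) theta
       (scal (- (1 / eta)) (curl (fun q => E (q, theta)) p))) /\
  (forall p theta,
     is_derive (fun t => E (p, t)) theta
       (scal eta (curl (fun q => H (q, theta)) p))) /\
  (forall p, H (p, 0) = Fh p) /\ (forall p, E (p, 0) = Fe p).

Definition curl_growth (C A beta : R) (F : R3 -> R3) : Prop :=
  eventually (fun n => forall p,
    norm (curl_iter n F p) <= C * A ^ n * Rpower (INR (fact n)) beta).

(* Main.v *)
Require Import Defs.
From Stdlib Require Import Reals List Arith Lra Lia.
From Stdlib Require Import Classical IndefiniteDescription FunctionalExtensionality.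
From Coquelicot Require Import Coquelicot.
Import ListNotations.
Open Scope R_scope.

(** The series are the Taylor series in time of the fields. If
    [H' = a curl E] and [E' = b curl H] with [a = - 1 / eta] and [b = eta], the
    [n]-th time derivative of [H] at time [0] is a multiple of the [n]-fold curl of
    [Fh] (for [n] even) or of [Fe] (for [n] odd), and [E] is obtained by exchanging
    the roles of the fields and of [a] and [b]; [maxwell_coeff] generates these time
    derivatives and [even_odd_expansion] identifies the fields of the theorem with
    their Taylor series. Maxwell's equations are then the recursion between
    the coefficients, read term by term ([generating_field_evolution]). As
    [beta < 1], the assumed growth of the iterated curls is that of the derivatives
    of an entire function ([entire_growth]), which gives the convergence of the
    series.

    What remains is to differentiate the series term by term in space, as often as
    one likes, although the hypothesis bounds curls only and not single partial
    derivatives. As the coefficients are divergence-free and [a b = -1], the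
    Laplacian of each coefficient is the coefficient two places further
    ([maxwell_coeff_wave]), so it is bounded as well. A function on the whole space
    with [|f| <= M] and [|Laplacian f| <= N] has partial derivatives of size at most
    [3 M + N / 2] ([interior_gradient_estimate]), which follows from the maximum
    principle on a half cube by comparison with an explicit quadratic barrier
    ([half_cube_barrier]). Hence the partial derivatives of the coefficients are
    again bounded by derivatives of an entire function and again satisfy the
    Laplacian recursion ([wave_family_partial]). The class of such families is stable
    under differentiation in space and in time, and each of its Taylor series is
    continuous, so all of them are smooth ([wave_family_smooth]). *)

(** * Maxima over a box *)

Definition in_box (a b q : R3) : Prop :=
  cx a <= cx q <= cx b /\ cy a <= cy q <= cy b /\ cz a <= cz q <= cz b.

(** If no point were maximal, each point would have a neighbourhood on which
    [w] stays below some other value of [w]; finitely many such neighbourhoods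
    cover the box, and the largest of the finitely many values that dominate
    them would be smaller than itself. *)
Lemma max_on_box (w : R3 -> R) (a b : R3) :
  (forall q, continuous w q) -> in_box a b a ->
  exists q, in_box a b q /\ forall s, in_box a b s -> w s <= w q.
Proof.
intros Cw Ha.
apply NNPP; intros Hno.
assert (Hup : forall q, in_box a b q -> exists s, in_box a b s /\ w q < w s).
{ intros q Hq; apply NNPP; intros H; apply Hno; exists q; split; auto.
  intros s Hs; apply Rnot_lt_le; intros Hlt; apply H; now exists s. }
set (pt := fun t : Compactness.Tn 3 R =>
  let '(x, (y, (z, _))) := t in ((x, y, z) : R3)).
set (tp := fun q : R3 => ((cx q, (cy q, (cz q, tt))) : Compactness.Tn 3 R)).
assert (Hloc : forall t, exists d : posreal, in_box a b (pt t) ->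
  exists s, in_box a b s /\ forall x, close_n 3 d x t -> w (pt x) < w s).
{ intros t.
  destruct (classic (in_box a b (pt t))) as [Ht|Ht].
  2: { exists (mkposreal 1 Rlt_0_1); intros; contradiction. }
  destruct (Hup _ Ht) as (s & Hs & Hlt).
  assert (He : 0 < w s - w (pt t)) by lra.
  destruct (proj1 (filterlim_locally w (w (pt t))) (Cw (pt t)) (mkposreal _ He))
    as (d & Hd).
  exists d; intros _; exists s; split; auto.
  intros x Hx; specialize (Hd (pt x)).
  destruct t as (t1 & t2 & t3 & []), x as (x1 & x2 & x3 & []).
  simpl in Hx; destruct Hx as (H1 & H2 & H3 & _).
  assert (Hb : ball (pt (t1, (t2, (t3, tt)))) d (pt (x1, (x2, (x3, tt))))).
  { exact (conj (conj H1 H2) H3). }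
  specialize (Hd Hb); change (Rabs (w (pt (x1, (x2, (x3, tt)))) - w (pt (t1, (t2, (t3, tt)))))
    < w s - w (pt (t1, (t2, (t3, tt))))) in Hd.
  destruct (Rabs_def2 _ _ Hd) as [Hd1 _]; clear Hd; apply (Rplus_lt_reg_r (- w (pt (t1, (t2, (t3, tt)))))); exact Hd1. }
destruct (functional_choice _ Hloc) as (delta & Hdelta); clear Hloc.
apply (compactness_list 3 (tp a) (tp b) delta); intros (l & Hl).
assert (Htp : forall q, in_box a b q -> bounded_n 3 (tp a) (tp b) (tp q)).
{ intros q (H1 & H2 & H3); exact (conj H1 (conj H2 (conj H3 I))). }
assert (Hpt : forall t, bounded_n 3 (tp a) (tp b) t -> in_box a b (pt t)).
{ intros (t1 & t2 & t3 & []) (H1 & H2 & H3 & _); exact (conj H1 (conj H2 H3)). }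
assert (Hs : exists s, in_box a b s /\ forall t, In t l -> in_box a b (pt t) ->
  forall x, close_n 3 (delta t) x t -> w (pt x) < w s).
{ clear Hl; induction l as [|t l (s & Hs & IH)].
  - exists a; split; auto; intros t [].
  - destruct (classic (in_box a b (pt t))) as [Ht|Ht].
    + destruct (Hdelta t Ht) as (s' & Hs' & H').
      destruct (Rle_dec (w s) (w s')) as [Hle|Hle].
      * exists s'; split; auto; intros t0 [<-|H0] Hb x Hx; auto.
        apply Rlt_le_trans with (2 := Hle); eauto.
      * exists s; split; auto; intros t0 [<-|H0] Hb x Hx; eauto.
        apply Rlt_trans with (w s'); auto; lra.
    + exists s; split; auto; intros t0 [<-|H0] Hb x Hx; eauto; contradiction. }
destruct Hs as (s & Hs & Hmax).
destruct (Hl (tp s) (Htp s Hs)) as (t & Hin & Hbt & Hclose).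
specialize (Hmax t Hin (Hpt t Hbt) _ Hclose).
destruct s as [[s1 s2] s3]; apply (Rlt_irrefl (w (s1, s2, s3))); exact Hmax.
Qed.

(** At the maximum the slope [g1] vanishes, so a positive [d2] would make [g1]
    positive, hence [g] increasing, just to the right of [x]. *)
Lemma second_derivative_at_max (g g1 : R -> R) (x d2 r : R) :
  0 < r -> (forall t, is_derive g t (g1 t)) -> is_derive g1 x d2 ->
  (forall t, Rabs (t - x) < r -> g t <= g x) -> d2 <= 0.
Proof.
intros Hr Hg Hg1 Hmax.
assert (pr : derivable_pt g x) by (exists (g1 x); now apply is_derive_Reals).
assert (E0 : g1 x = 0).
{ rewrite <- (is_derive_unique _ _ _ (Hg x)), <- (Derive_Reals g x pr).
  apply (deriv_maximum g (x - r) (x + r)); try lra.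
  intros t H1 H2; apply Hmax, Rabs_def1; lra. }
apply Rnot_lt_le; intros Hpos.
assert (He : 0 < d2 / 2) by lra.
destruct (proj1 (is_derive_Reals _ _ _) Hg1 _ He) as (d & Hd).
set (h := Rmin d r / 2).
assert (Hh : 0 < h < d /\ h < r).
{ unfold h; generalize (cond_pos d) (Rmin_l d r) (Rmin_r d r); intros.
  assert (0 < Rmin d r) by (now apply Rmin_pos); lra. }
destruct (MVT_cor2 g g1 x (x + h)) as (c & Hc & Hcx); try lra.
{ intros; now apply is_derive_Reals. }
assert (Hgc : 0 < g1 c).
{ specialize (Hd (c - x)); rewrite E0 in Hd.
  replace (x + (c - x)) with c in Hd by ring.
  assert (Rabs (c - x) < d) by (rewrite Rabs_pos_eq; lra).
  specialize (Hd ltac:(lra) H); apply Rabs_def2 in Hd.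
  apply Rmult_lt_reg_r with (/ (c - x)); [apply Rinv_0_lt_compat; lra|].
  unfold Rdiv in Hd; rewrite Rminus_0_r in Hd; lra. }
specialize (Hmax (x + h)); rewrite Rabs_pos_eq in Hmax by lra.
assert (g (x + h) <= g x) by (apply Hmax; lra).
assert (0 < g1 c * (x + h - x)) by (apply Rmult_lt_0_compat; lra); lra.
Qed.

(** * Calculus of directional derivatives *)

Lemma plus_scal_0 {V : NormedModule R_AbsRing} (p e : V) : plus p (scal 0 e) = p.
Proof. rewrite (scal_zero_l (V := V)); apply plus_zero_r. Qed.

Definition smooth_scalar {V : NormedModule R_AbsRing} (B : list V) (f : V -> R) : Prop :=
  forall k, class_C B k f.

Lemma smooth_scalar_continuous {V : NormedModule R_AbsRing} (B : list V) (f : V -> R) :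
  smooth_scalar B f -> forall p, continuous f p.
Proof. intros Hf; exact (Hf 0%nat). Qed.

Lemma smooth_scalar_partial {V : NormedModule R_AbsRing} (B : list V) (f : V -> R) e :
  In e B -> smooth_scalar B f -> smooth_scalar B (partial e f).
Proof. intros He Hf k; exact (proj2 (Hf (S k) e He)). Qed.

(** [partial] differentiates at the parameter [0] only; moving the base point along
    the line gives the derivative at every parameter. *)
Lemma is_derive_along {V : NormedModule R_AbsRing} (B : list V) (f : V -> R) e p t :
  In e B -> smooth_scalar B f ->
  is_derive (fun s => f (plus p (scal s e))) t (partial e f (plus p (scal t e))).
Proof.
intros He Hf.
assert (Hex := proj1 (Hf 1%nat e He) (plus p (scal t e))).
apply Derive_correct in Hex.
fold (partial e f (plus p (scal t e))) in Hex.
assert (Hs : is_derive (fun s => s - t) t 1) by (auto_derive; auto).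
replace (partial e f (plus p (scal t e))) with
  (scal 1 (partial e f (plus p (scal t e)))) by apply Rmult_1_l.
apply is_derive_ext with
  (fun s => f (plus (plus p (scal t e)) (scal (s - t) e))).
- intros s; rewrite <- plus_assoc, <- scal_distr_r.
  do 3 f_equal; change (t + (s - t) = s); ring.
- apply (is_derive_comp (fun s => f (plus (plus p (scal t e)) (scal s e)))
    (fun s => s - t)); auto.
  now rewrite Rminus_diag.
Qed.

Lemma partial_scal {V : NormedModule R_AbsRing} (e : V) (f : V -> R) c :
  partial e (fun q => c * f q) = (fun p => c * partial e f p).
Proof.
apply functional_extensionality; intros p; unfold partial; apply Derive_scal.
Qed.

Lemma class_C_scal {V : NormedModule R_AbsRing} (B : list V) k (f : V -> R) c :
  class_C B k f -> class_C B k (fun q => c * f q).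
Proof.
revert f; induction k as [|k IH]; intros f Hf.
- intros p; apply (continuous_mult (K := R_AbsRing)); [apply continuous_const|apply Hf].
- intros e He; destruct (Hf e He) as [H1 H2]; split.
  + intros p; apply ex_derive_scal, H1.
  + rewrite partial_scal; auto.
Qed.

Lemma class_C_minus {V : NormedModule R_AbsRing} (B : list V) k (f g : V -> R) :
  class_C B k f -> class_C B k g -> class_C B k (fun q => f q - g q).
Proof.
revert f g; induction k as [|k IH]; intros f g Hf Hg.
- intros p; apply (continuous_minus (V := R_NormedModule)); [apply Hf|apply Hg].
- intros e He; destruct (Hf e He) as [H1 H2], (Hg e He) as [H3 H4]; split.
  + intros p; apply (ex_derive_minus (V := R_NormedModule)); [apply H1|apply H3].
  + replace (partial e (fun q => f q - g q)) with (fun p => partial e f p - partial e g p).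
    * auto.
    * apply functional_extensionality; intros p; symmetry; apply Derive_minus;
        [apply H1|apply H3].
Qed.

Lemma class_C_plus {V : NormedModule R_AbsRing} (B : list V) k (f g : V -> R) :
  class_C B k f -> class_C B k g -> class_C B k (fun q => f q + g q).
Proof.
intros Hf Hg; replace (fun q => f q + g q) with (fun q => f q - -1 * g q).
- now apply class_C_minus; [|apply class_C_scal].
- apply functional_extensionality; intros; ring.
Qed.

Lemma partial_plus {V : NormedModule R_AbsRing} (B : list V) (e : V) (f g : V -> R) :
  In e B -> smooth_scalar B f -> smooth_scalar B g ->
  partial e (fun q => f q + g q) = (fun p => partial e f p + partial e g p).
Proof.
intros He Hf Hg; apply functional_extensionality; intros p; apply Derive_plus.
- exact (proj1 (Hf 1%nat e He) p).
- exact (proj1 (Hg 1%nat e He) p).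
Qed.

Lemma partial_minus {V : NormedModule R_AbsRing} (B : list V) (e : V) (f g : V -> R) :
  In e B -> smooth_scalar B f -> smooth_scalar B g ->
  partial e (fun q => f q - g q) = (fun p => partial e f p - partial e g p).
Proof.
intros He Hf Hg; apply functional_extensionality; intros p; apply Derive_minus.
- exact (proj1 (Hf 1%nat e He) p).
- exact (proj1 (Hg 1%nat e He) p).
Qed.

(** Schwarz's theorem in the plane through [p] spanned by [e] and [e']. *)
Lemma partial_comm {V : NormedModule R_AbsRing} (B : list V) (e e' : V) (f : V -> R) :
  In e B -> In e' B -> smooth_scalar B f ->
  partial e (partial e' f) = partial e' (partial e f).
Proof.
intros He He' Hf; apply functional_extensionality; intros p.
set (F := fun u v => f (plus (plus p (scal u e)) (scal v e'))).
assert (Ec : forall u v, plus (plus p (scal u e)) (scal v e') =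
  plus (plus p (scal v e')) (scal u e)).
{ intros u v; rewrite <- !plus_assoc; f_equal; apply plus_comm. }
assert (A1 : forall g u v, smooth_scalar B g ->
  is_derive (fun t => g (plus (plus p (scal t e)) (scal v e'))) u
    (partial e g (plus (plus p (scal u e)) (scal v e')))).
{ intros g u v Hg; rewrite Ec.
  apply is_derive_ext with (2 := is_derive_along B g e _ u He Hg).
  intros t; now rewrite Ec. }
assert (A2 : forall g u v, smooth_scalar B g ->
  is_derive (fun t => g (plus (plus p (scal u e)) (scal t e'))) v
    (partial e' g (plus (plus p (scal u e)) (scal v e')))).
{ intros g u v Hg; exact (is_derive_along B g e' _ v He' Hg). }
assert (S1 := smooth_scalar_partial B f e He Hf).
assert (S2 := smooth_scalar_partial B f e' He' Hf).
assert (S12 := smooth_scalar_partial B _ e He S2).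
assert (S21 := smooth_scalar_partial B _ e' He' S1).
assert (D1 : forall u v, Derive (fun t => F t v) u =
  partial e f (plus (plus p (scal u e)) (scal v e'))).
{ intros u v; apply is_derive_unique, (A1 f); auto. }
assert (D2 : forall u v, Derive (fun t => F u t) v =
  partial e' f (plus (plus p (scal u e)) (scal v e'))).
{ intros u v; apply is_derive_unique, (A2 f); auto. }
assert (D12 : forall u v, Derive (fun z => Derive (fun t => F z t) v) u =
  partial e (partial e' f) (plus (plus p (scal u e)) (scal v e'))).
{ intros u v; apply is_derive_unique.
  apply is_derive_ext with (2 := A1 _ u v S2); intros t; now rewrite D2. }
assert (D21 : forall u v, Derive (fun z => Derive (fun t => F t z) u) v =
  partial e' (partial e f) (plus (plus p (scal u e)) (scal v e'))).
{ intros u v; apply is_derive_unique.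
  apply is_derive_ext with (2 := A2 _ u v S1); intros t; now rewrite D1. }
assert (E0 : p = plus (plus p (scal 0 e)) (scal 0 e')).
{ now rewrite !plus_scal_0. }
assert (Cont : forall g, smooth_scalar B g -> forall u v,
  continuity_2d_pt (fun u v => g (plus (plus p (scal u e)) (scal v e'))) u v).
{ intros g Hg u v; apply continuity_2d_pt_filterlim.
  apply (continuous_comp (fun w : R * R => plus (plus p (scal (fst w) e)) (scal (snd w) e')) g (u, v));
    [|apply (smooth_scalar_continuous B g Hg)].
  repeat apply (continuous_plus (V := V)); try apply continuous_const;
  apply (continuous_scal_l (V := V)); [apply continuous_fst|apply continuous_snd]. }
rewrite E0, <- D12, <- D21.
apply Schwarz.
- exists posreal_one; intros u v _ _; repeat split.
  + eexists; apply (A1 f); auto.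
  + eexists; apply (A2 f); auto.
  + eexists; apply is_derive_ext with (2 := A1 _ u v S2); intros t; now rewrite D2.
  + eexists; apply is_derive_ext with (2 := A2 _ u v S1); intros t; now rewrite D1.
- apply continuity_2d_pt_ext with (2 := Cont _ S12 0 0); intros; now rewrite D12.
- apply continuity_2d_pt_ext with (2 := Cont _ S21 0 0); intros; now rewrite D21.
Qed.

(** * Interior gradient estimate *)

Section HalfCube.

(** The field under study is read in affine coordinates; subscripts name the
    partial derivatives. *)
Context {U U1 U2 U3 U11 U22 U33 : R -> R -> R -> R}.
Hypothesis CU : forall q : R3, continuous (fun q : R3 => U (cx q) (cy q) (cz q)) q.
Hypothesis DU1 : forall x y z, is_derive (fun t => U t y z) x (U1 x y z).
Hypothesis DU2 : forall x y z, is_derive (fun t => U x t z) y (U2 x y z).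
Hypothesis DU3 : forall x y z, is_derive (fun t => U x y t) z (U3 x y z).
Hypothesis DU11 : forall x y z, is_derive (fun t => U1 t y z) x (U11 x y z).
Hypothesis DU22 : forall x y z, is_derive (fun t => U2 x t z) y (U22 x y z).
Hypothesis DU33 : forall x y z, is_derive (fun t => U3 x y t) z (U33 x y z).

(** The odd part of [U] in [z] vanishes on the face [z = 0] and has the same
    [z]-derivative at the origin as [U]. *)
Let phi x y z := (U x y z - U x y (- z)) / 2.
(** The barrier: its Laplacian is [- N], since [2 + 2 - 4 = 0] cancels the terms
    with [M]. *)
Let psi (M N x y z : R) := M * (x ^ 2 + y ^ 2 + z * (3 - 2 * z)) + N / 2 * (z * (1 - z)).

(** The maximum principle on the half cube with [|x| <= 1], [|y| <= 1],
    [0 <= z <= 1]: the difference of [phi] and the barrier has positive Laplacian,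
    so it is largest on the boundary. *)
Lemma half_cube_barrier (M N z : R) :
  (forall x y z, Rabs (U x y z) <= M) ->
  (forall x y z, Rabs (U11 x y z + U22 x y z + U33 x y z) < N) ->
  0 <= z <= 1 -> phi 0 0 z <= psi M N 0 0 z.
Proof.
intros HM HN Hz.
assert (M0 : 0 <= M) by (apply Rle_trans with (2 := HM 0 0 0), Rabs_pos).
assert (N0 : 0 < N) by (apply Rle_lt_trans with (2 := HN 0 0 0), Rabs_pos).
assert (Hphi : forall x y z, phi x y z <= M).
{ intros x y t; unfold phi.
  generalize (HM x y t) (HM x y (- t)); intros H1 H2.
  apply Rabs_le_between in H1; apply Rabs_le_between in H2; lra. }
set (w := fun q : R3 => phi (cx q) (cy q) (cz q) - psi M N (cx q) (cy q) (cz q)).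
assert (Ccx : forall q : R3, continuous cx q).
{ intros q; apply (continuous_comp fst fst); apply continuous_fst. }
assert (Ccy : forall q : R3, continuous cy q).
{ intros q; apply (continuous_comp fst snd); [apply continuous_fst|apply continuous_snd]. }
assert (Ccz : forall q : R3, continuous cz q) by (intros q; apply continuous_snd).
assert (Cw : forall q, continuous w q).
{ intros q; unfold w.
  apply (continuous_minus (V := R_NormedModule)).
  - unfold phi, Rdiv.
    apply (continuous_mult (K := R_AbsRing)); [|apply continuous_const].
    apply (continuous_minus (V := R_NormedModule)); [apply CU|].
    apply (continuous_comp (fun q : R3 => (cx q, cy q, - cz q) : R3)
       (fun q : R3 => U (cx q) (cy q) (cz q))); [|apply CU].
    apply (continuous_comp_2 (fun q : R3 => (cx q, cy q)) (fun q => - cz q)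
      (fun a b => (a, b))).
    + apply (continuous_comp_2 (fun q : R3 => cx q) (fun q => cy q) (fun a b => (a, b)));
        auto; apply continuous_ext with (fun q => q); [now intros []|apply continuous_id].
    + apply (continuous_opp (V := R_NormedModule)); auto.
    + apply continuous_ext with (fun q => q); [now intros []|apply continuous_id].
  - unfold psi; simpl; unfold Rminus.
    repeat match goal with
    | |- continuous (fun q => @?f q + @?g q) _ =>
        apply (continuous_plus (V := R_NormedModule) f g)
    | |- continuous (fun q => @?f q * @?g q) _ =>
        apply (continuous_mult (K := R_AbsRing) f g)
    | |- continuous (fun q => - @?f q) _ =>
        apply (continuous_opp (V := R_NormedModule) f)
    | |- continuous (fun q => cx q) _ => apply Ccx
    | |- continuous (fun q => cy q) _ => apply Ccy
    | |- continuous (fun q => cz q) _ => apply Ccz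
    | |- continuous (fun q => _) _ => apply continuous_const
    end. }
destruct (max_on_box w (-1, -1, 0) (1, 1, 1) Cw) as (((x0, y0), z0) & Hbox & Hmax).
{ unfold in_box, cx, cy, cz; simpl; lra. }
unfold in_box, cx, cy, cz in Hbox; simpl in Hbox; destruct Hbox as (Hx0 & Hy0 & Hz0).
(* [phi <= psi] on the faces: on [z = 0] because [phi] is odd, on the other five
   because [psi >= M] there. *)
assert (Hw0 : w (x0, y0, z0) <= 0).
2: { specialize (Hmax (0, 0, z)).
     assert (w (0, 0, z) <= w (x0, y0, z0)) by (apply Hmax; unfold in_box, cx, cy, cz; simpl; lra).
     change (phi 0 0 z - psi M N 0 0 z <= w (x0, y0, z0)) in H; lra. }
assert (Hq : 0 <= z0 * (3 - 2 * z0) /\ 0 <= z0 * (1 - z0)).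
{ split; apply Rmult_le_pos; lra. }
assert (Hedge : 1 <= x0 ^ 2 + y0 ^ 2 + z0 * (3 - 2 * z0) -> w (x0, y0, z0) <= 0).
{ intros H1; unfold w, psi; unfold cx, cy, cz; simpl fst; simpl snd.
  specialize (Hphi x0 y0 z0).
  assert (0 <= N / 2 * (z0 * (1 - z0))) by (apply Rmult_le_pos; lra).
  assert (M * 1 <= M * (x0 ^ 2 + y0 ^ 2 + z0 * (3 - 2 * z0)))
    by (apply Rmult_le_compat_l; auto); lra. }
assert (Hx2 : 0 <= x0 ^ 2) by apply pow2_ge_0.
assert (Hy2 : 0 <= y0 ^ 2) by apply pow2_ge_0.
destruct (Req_dec x0 (-1)) as [->|]; [apply Hedge; lra|].
destruct (Req_dec x0 1) as [->|]; [apply Hedge; lra|].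
destruct (Req_dec y0 (-1)) as [->|]; [apply Hedge; lra|].
destruct (Req_dec y0 1) as [->|]; [apply Hedge; lra|].
destruct (Req_dec z0 1) as [->|]; [apply Hedge; lra|].
destruct (Req_dec z0 0) as [->|].
{ unfold w, phi, psi; unfold cx, cy, cz; simpl fst; simpl snd.
  rewrite Ropp_0; assert (0 <= M * (x0 ^ 2 + y0 ^ 2)) by (apply Rmult_le_pos; lra); lra. }
(* Away from the faces the three second derivatives of [w] are nonpositive, whereas
   their sum is the Laplacian of [phi] plus [N], which is positive. *)
exfalso.
pose (G1 x y z := (U1 x y z - U1 x y (- z)) / 2 - 2 * M * x).
pose (G2 x y z := (U2 x y z - U2 x y (- z)) / 2 - 2 * M * y).
pose (G3 x y z := (U3 x y z + U3 x y (- z)) / 2 - M * (3 - 4 * z) - N / 2 * (1 - 2 * z)).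
set (r := Rmin (Rmin (Rmin (x0 + 1) (1 - x0)) (Rmin (y0 + 1) (1 - y0))) (Rmin z0 (1 - z0))).
assert (Hr : 0 < r) by (unfold r; repeat apply Rmin_pos; lra).
assert (Hrr : r <= x0 + 1 /\ r <= 1 - x0 /\ r <= y0 + 1 /\ r <= 1 - y0 /\ r <= z0 /\ r <= 1 - z0).
{ unfold r; repeat split; unfold Rmin; repeat destruct Rle_dec; lra. }
assert (D1 : (U11 x0 y0 z0 - U11 x0 y0 (- z0)) / 2 - 2 * M <= 0).
{ apply (second_derivative_at_max (fun t => w (t, y0, z0)) (fun t => G1 t y0 z0) x0 _ r Hr).
  - intros t; unfold w, phi, psi, G1; unfold cx, cy, cz; simpl fst; simpl snd.
    generalize (DU1 t y0 z0) (DU1 t y0 (- z0)); intros H5 H6.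
    auto_derive; [repeat split; auto; eexists; eassumption|].
    rewrite (is_derive_unique (fun x : R => U x y0 z0) _ _ H5).
    rewrite (is_derive_unique (fun x : R => U x y0 (- z0)) _ _ H6). lra.
  - unfold G1.
    generalize (DU11 x0 y0 z0) (DU11 x0 y0 (- z0)); intros H5 H6.
    auto_derive; [repeat split; auto; eexists; eassumption|].
    rewrite (is_derive_unique (fun x : R => U1 x y0 z0) _ _ H5).
    rewrite (is_derive_unique (fun x : R => U1 x y0 (- z0)) _ _ H6). lra.
  - intros t Ht; apply Rabs_def2 in Ht; apply Hmax; unfold in_box, cx, cy, cz; simpl; lra. }
assert (D2 : (U22 x0 y0 z0 - U22 x0 y0 (- z0)) / 2 - 2 * M <= 0).
{ apply (second_derivative_at_max (fun t => w (x0, t, z0)) (fun t => G2 x0 t z0) y0 _ r Hr).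
  - intros t; unfold w, phi, psi, G2; unfold cx, cy, cz; simpl fst; simpl snd.
    generalize (DU2 x0 t z0) (DU2 x0 t (- z0)); intros H5 H6.
    auto_derive; [repeat split; auto; eexists; eassumption|].
    rewrite (is_derive_unique (fun x : R => U x0 x z0) _ _ H5).
    rewrite (is_derive_unique (fun x : R => U x0 x (- z0)) _ _ H6). lra.
  - unfold G2.
    generalize (DU22 x0 y0 z0) (DU22 x0 y0 (- z0)); intros H5 H6.
    auto_derive; [repeat split; auto; eexists; eassumption|].
    rewrite (is_derive_unique (fun x : R => U2 x0 x z0) _ _ H5).
    rewrite (is_derive_unique (fun x : R => U2 x0 x (- z0)) _ _ H6). lra.
  - intros t Ht; apply Rabs_def2 in Ht; apply Hmax; unfold in_box, cx, cy, cz; simpl; lra. }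
assert (D3 : (U33 x0 y0 z0 - U33 x0 y0 (- z0)) / 2 + 4 * M + N <= 0).
{ apply (second_derivative_at_max (fun t => w (x0, y0, t)) (fun t => G3 x0 y0 t) z0 _ r Hr).
  - intros t; unfold w, phi, psi, G3; unfold cx, cy, cz; simpl fst; simpl snd.
    generalize (DU3 x0 y0 t) (DU3 x0 y0 (- t)); intros H5 H6.
    auto_derive; [repeat split; auto; eexists; eassumption|].
    rewrite (is_derive_unique (fun x : R => U x0 y0 x) _ _ H5).
    rewrite (is_derive_unique (fun x : R => U x0 y0 x) _ _ H6). lra.
  - unfold G3.
    generalize (DU33 x0 y0 z0) (DU33 x0 y0 (- z0)); intros H5 H6.
    auto_derive; [repeat split; auto; eexists; eassumption|].
    rewrite (is_derive_unique (fun x : R => U3 x0 y0 x) _ _ H5).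
    rewrite (is_derive_unique (fun x : R => U3 x0 y0 x) _ _ H6). lra.
  - intros t Ht; apply Rabs_def2 in Ht; apply Hmax; unfold in_box, cx, cy, cz; simpl; lra. }
generalize (HN x0 y0 z0) (HN x0 y0 (- z0)); intros H5 H6.
apply Rabs_def2 in H5; apply Rabs_def2 in H6; lra.
Qed.

(** [phi] and the barrier agree at the origin, so [phi <= psi] for small [z >= 0]
    compares their [z]-derivatives there. *)
Lemma derivative_upper_bound (M N : R) :
  (forall x y z, Rabs (U x y z) <= M) ->
  (forall x y z, Rabs (U11 x y z + U22 x y z + U33 x y z) < N) ->
  U3 0 0 0 <= 3 * M + N / 2.
Proof.
intros HM HN.
apply Rnot_lt_le; intros Hlt.
pose (g z := M * (z * (3 - 2 * z)) + N / 2 * (z * (1 - z)) - (U 0 0 z - U 0 0 (- z)) / 2).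
assert (Dg : is_derive g 0 (3 * M + N / 2 - U3 0 0 0)).
{ unfold g; generalize (DU3 0 0 0); intros H5.
  auto_derive.
  - rewrite Ropp_0; repeat split; auto; eexists; eassumption.
  - rewrite Ropp_0, (is_derive_unique (fun x : R => U 0 0 x) _ _ H5); lra. }
assert (He : 0 < U3 0 0 0 - (3 * M + N / 2)) by lra.
destruct (proj1 (is_derive_Reals _ _ _) Dg _ He) as (d & Hd).
set (h := Rmin d 1 / 2).
assert (Hh : 0 < h < d /\ h < 1).
{ unfold h; generalize (cond_pos d) (Rmin_l d 1) (Rmin_r d 1); intros.
  assert (0 < Rmin d 1) by (apply Rmin_pos; lra); lra. }
specialize (Hd h ltac:(lra)); rewrite (Rabs_pos_eq h) in Hd by lra.
specialize (Hd ltac:(lra)); apply Rabs_def2 in Hd.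
rewrite Rplus_0_l in Hd.
assert (Eg0 : g 0 = 0) by (unfold g; rewrite Ropp_0; lra).
assert (Hgh : 0 <= g h).
{ generalize (half_cube_barrier M N h HM HN); intros Hb.
  specialize (Hb ltac:(lra)); unfold phi, psi in Hb; unfold g; lra. }
rewrite Eg0 in Hd.
assert (0 <= (g h - 0) / h).
{ apply Rmult_le_pos; [lra|]; apply Rlt_le, Rinv_0_lt_compat; lra. }
lra.
Qed.

End HalfCube.

Definition chart {V : NormedModule R_AbsRing} (p e1 e2 e3 : V) (x y z : R) : V :=
  plus p (plus (plus (scal x e1) (scal y e2)) (scal z e3)).

Lemma derivative_bound_strict {V : NormedModule R_AbsRing} (B : list V) (f : V -> R)
  (e1 e2 e3 p : V) (M N : R) :
  In e1 B -> In e2 B -> In e3 B -> smooth_scalar B f ->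
  (forall q, Rabs (f q) <= M) ->
  (forall q, Rabs (partial e1 (partial e1 f) q + partial e2 (partial e2 f) q
     + partial e3 (partial e3 f) q) < N) ->
  partial e3 f p <= 3 * M + N / 2.
Proof.
intros I1 I2 I3 Hf HM HN.
assert (L1 : forall g, smooth_scalar B g -> forall x y z,
  is_derive (fun t => g (chart p e1 e2 e3 t y z)) x (partial e1 g (chart p e1 e2 e3 x y z))).
{ intros g Hg x y z.
  assert (E : forall t, chart p e1 e2 e3 t y z =
    plus (plus p (plus (scal y e2) (scal z e3))) (scal t e1)).
  { intros t; unfold chart; rewrite <- (plus_assoc p); f_equal.
    rewrite <- plus_assoc; apply plus_comm. }
  rewrite E; apply is_derive_ext with (2 := is_derive_along B g e1 _ x I1 Hg).
  intros t; now rewrite E. }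
assert (L2 : forall g, smooth_scalar B g -> forall x y z,
  is_derive (fun t => g (chart p e1 e2 e3 x t z)) y (partial e2 g (chart p e1 e2 e3 x y z))).
{ intros g Hg x y z.
  assert (E : forall t, chart p e1 e2 e3 x t z =
    plus (plus p (plus (scal x e1) (scal z e3))) (scal t e2)).
  { intros t; unfold chart; rewrite <- (plus_assoc p); f_equal.
    rewrite <- !plus_assoc; f_equal; apply plus_comm. }
  rewrite E; apply is_derive_ext with (2 := is_derive_along B g e2 _ y I2 Hg).
  intros t; now rewrite E. }
assert (L3 : forall g, smooth_scalar B g -> forall x y z,
  is_derive (fun t => g (chart p e1 e2 e3 x y t)) z (partial e3 g (chart p e1 e2 e3 x y z))).
{ intros g Hg x y z.
  assert (E : forall t, chart p e1 e2 e3 x y t =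
    plus (plus p (plus (scal x e1) (scal y e2))) (scal t e3)).
  { intros t; unfold chart; now rewrite !plus_assoc. }
  rewrite E; apply is_derive_ext with (2 := is_derive_along B g e3 _ z I3 Hg).
  intros t; now rewrite E. }
assert (E0 : p = chart p e1 e2 e3 0 0 0).
{ unfold chart; rewrite !(scal_zero_l (V := V)), !plus_zero_r; auto. }
assert (S1 := smooth_scalar_partial B f e1 I1 Hf).
assert (S2 := smooth_scalar_partial B f e2 I2 Hf).
assert (S3 := smooth_scalar_partial B f e3 I3 Hf).
rewrite E0.
apply (derivative_upper_bound
  (U := fun x y z => f (chart p e1 e2 e3 x y z))
  (U3 := fun x y z => partial e3 f (chart p e1 e2 e3 x y z))) with
  (2 := L1 f Hf) (3 := L2 f Hf) (4 := L3 f Hf) (5 := L1 _ S1) (6 := L2 _ S2) (7 := L3 _ S3);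
  auto.
intros q.
apply (continuous_comp (fun q : R3 => chart p e1 e2 e3 (cx q) (cy q) (cz q)) f);
  [|apply (smooth_scalar_continuous B f Hf)].
unfold chart; repeat apply (continuous_plus (V := V)); try apply continuous_const;
  apply (continuous_scal_l (V := V)).
- apply (continuous_comp fst fst); apply continuous_fst.
- apply (continuous_comp fst snd); [apply continuous_fst|apply continuous_snd].
- apply continuous_snd.
Qed.

(** Since the bounds hold on the whole space, the unit half cube can be placed at any
    [p]; the estimate needs no bound on second derivatives other than the
    Laplacian, which is what makes it iterable here. *)
Lemma interior_gradient_estimate {V : NormedModule R_AbsRing} (B : list V) (f : V -> R)
  (e1 e2 e3 p : V) (M N : R) :
  In e1 B -> In e2 B -> In e3 B -> smooth_scalar B f ->
  (forall q, Rabs (f q) <= M) ->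
  (forall q, Rabs (partial e1 (partial e1 f) q + partial e2 (partial e2 f) q
     + partial e3 (partial e3 f) q) <= N) ->
  Rabs (partial e3 f p) <= 3 * M + N / 2.
Proof.
intros I1 I2 I3 Hf HM HN.
assert (Hup : forall g, smooth_scalar B g -> (forall q, Rabs (g q) <= M) ->
  (forall q, Rabs (partial e1 (partial e1 g) q + partial e2 (partial e2 g) q
     + partial e3 (partial e3 g) q) <= N) -> partial e3 g p <= 3 * M + N / 2).
{ intros g Hg Hg1 Hg2; apply le_epsilon; intros eps Heps.
  replace (3 * M + N / 2 + eps) with (3 * M + (N + 2 * eps) / 2) by field.
  apply (derivative_bound_strict B g e1 e2 e3); auto.
  intros q; specialize (Hg2 q); lra. }
apply Rabs_le; split; [|now apply Hup].
specialize (Hup (fun q => -1 * f q)); rewrite !partial_scal in Hup.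
enough (-1 * partial e3 f p <= 3 * M + N / 2) by lra.
apply Hup.
- intros k; now apply class_C_scal.
- intros q; rewrite Rabs_mult, Rabs_m1, Rmult_1_l; auto.
- intros q; rewrite <- !Rmult_plus_distr_l, Rabs_mult, Rabs_m1, Rmult_1_l; auto.
Qed.

(** * Entire majorants and Taylor series in time *)

(** The exponential generating series of [b] is an entire function. *)
Definition entire (b : nat -> R) : Prop :=
  CV_radius (fun n => b n / INR (fact n)) = p_infty.

Lemma CV_radius_infinite (a : nat -> R) :
  (forall x, ex_series (fun n => Rabs (a n * x ^ n))) -> CV_radius a = p_infty.
Proof.
intros H.
assert (Hub : forall x : R, Rbar_le x (CV_radius a)).
{ intros x; apply (proj1 (Lub_Rbar_correct (CV_disk a))), H. }
destruct (CV_radius a) as [r| |]; auto.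
- generalize (Hub (r + 1)); simpl; lra.
- destruct (Hub 0).
Qed.

Lemma entire_summable (b : nat -> R) (x : R) :
  entire b -> ex_series (fun n => Rabs (b n / INR (fact n) * x ^ n)).
Proof. intros Hb; apply CV_disk_inside; rewrite Hb; exact I. Qed.

(** Shifting the sequence differentiates its exponential generating series. *)
Lemma entire_shift (b : nat -> R) : entire b -> entire (fun n => b (S n)).
Proof.
intros Hb; unfold entire; rewrite <- Hb, <- (CV_radius_derive (fun n => b n / INR (fact n))).
apply CV_radius_ext; intros n; unfold PS_derive.
rewrite fact_simpl, mult_INR; field; split; [apply INR_fact_neq_0|now apply not_0_INR].
Qed.

Lemma entire_scal (b : nat -> R) (c : R) : entire b -> entire (fun n => c * b n).
Proof.
intros Hb; apply CV_radius_infinite; intros x.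
apply ex_series_ext with (fun n => scal (Rabs c) (Rabs (b n / INR (fact n) * x ^ n))).
- intros n; change (Rabs c * Rabs (b n / INR (fact n) * x ^ n) =
    Rabs (c * b n / INR (fact n) * x ^ n)).
  rewrite <- Rabs_mult; f_equal; unfold Rdiv; ring.
- now apply (ex_series_scal (V := R_NormedModule)), entire_summable.
Qed.

Lemma entire_plus (b c : nat -> R) :
  entire b -> entire c -> entire (fun n => b n + c n).
Proof.
intros Hb Hc; apply CV_radius_infinite; intros x.
apply (ex_series_le (V := R_CompleteNormedModule)) with
  (fun n => plus (Rabs (b n / INR (fact n) * x ^ n)) (Rabs (c n / INR (fact n) * x ^ n))).
- intros n; change (Rabs (Rabs ((b n + c n) / INR (fact n) * x ^ n)) <=
    Rabs (b n / INR (fact n) * x ^ n) + Rabs (c n / INR (fact n) * x ^ n)).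
  rewrite Rabs_Rabsolu; eapply Rle_trans; [|apply Rabs_triang].
  right; f_equal; unfold Rdiv; ring.
- now apply (ex_series_plus (V := R_NormedModule)); apply entire_summable.
Qed.

(** The terms at [2 * x] are bounded, and those at [x] are smaller by [2 ^ n]; this
    form survives passing to subsequences of indices. *)
Lemma entire_geometric (b : nat -> R) (x : R) :
  entire b -> exists K, 0 <= K /\ forall n, Rabs (b n / INR (fact n) * x ^ n) <= K * (1 / 2) ^ n.
Proof.
intros Hb.
destruct (filterlim_bounded (K := R_AbsRing) (V := R_NormedModule)
  (fun n => Rabs (b n / INR (fact n) * (2 * x) ^ n))) as (K & HK).
{ exists 0; apply ex_series_lim_0, entire_summable, Hb. }
exists K; split; [apply Rle_trans with (2 := HK 0%nat), norm_ge_0|].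
intros n; specialize (HK n).
change (Rabs (Rabs (b n / INR (fact n) * (2 * x) ^ n)) <= K) in HK.
rewrite Rabs_Rabsolu in HK.
replace (b n / INR (fact n) * x ^ n) with
  (b n / INR (fact n) * (2 * x) ^ n * (1 / 2) ^ n).
- rewrite Rabs_mult, (Rabs_pos_eq ((1 / 2) ^ n)) by (apply pow_le; lra).
  apply Rmult_le_compat_r; auto; apply pow_le; lra.
- rewrite Rmult_assoc, <- Rpow_mult_distr; repeat f_equal; field.
Qed.

(** The majorant is only required eventually: the first terms cancel in the
    difference between partial sum and sum, so they may be unbounded in [x]. *)
Lemma weierstrass_m_test {X : Type} (D : X -> Prop) (a : nat -> X -> R) (M : nat -> R) :
  ex_series M ->
  eventually (fun n => forall x, D x -> Rabs (a n x) <= M n) ->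
  (forall x, D x -> ex_series (fun n => Rabs (a n x))) /\
  (forall eps, 0 < eps -> eventually (fun N => forall x, D x ->
     Rabs (sum_n (fun n => a n x) N - Series (fun n => a n x)) < eps)).
Proof.
intros HM (N0 & HN0).
assert (Habs : forall N, (N0 <= N)%nat -> forall x, D x ->
  ex_series (fun n => Rabs (a (N + n)%nat x))).
{ intros N HN x Hx.
  apply (ex_series_le (V := R_CompleteNormedModule)) with (fun n => M (N + n)%nat).
  - intros n; change (Rabs (Rabs (a (N + n)%nat x)) <= M (N + n)%nat).
    rewrite Rabs_Rabsolu; apply HN0; auto; lia.
  - now apply ex_series_incr_n. }
assert (Hex : forall x, D x -> ex_series (fun n => Rabs (a n x))).
{ intros x Hx; apply ex_series_incr_n with N0; now apply Habs. }
split; auto.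
intros eps Heps.
destruct (proj2 (is_lim_seq_spec _ (Finite _)) (Series_correct _ HM) (mkposreal _ Heps)) as (N1 & HN1).
exists (Nat.max N0 N1); intros N HN x Hx.
specialize (HN1 N ltac:(lia)); simpl in HN1.
rewrite (Series_incr_n _ (S N)) by (try lia; apply ex_series_Rabs; auto).
rewrite (Series_incr_n M (S N)) in HN1 by (auto; lia).
simpl Init.Nat.pred in *; rewrite sum_n_Reals in *.
replace (sum_f_R0 (fun n => a n x) N - (sum_f_R0 (fun n => a n x) N +
  Series (fun k => a (S N + k)%nat x))) with (- Series (fun k => a (S N + k)%nat x)) by ring.
rewrite Rabs_Ropp.
apply Rle_lt_trans with (Series (fun k => M (S N + k)%nat)).
- eapply Rle_trans; [apply Series_Rabs, Habs; auto; lia|].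
  apply Series_le.
  + intros n; split; [apply Rabs_pos|apply HN0; auto; lia].
  + now apply ex_series_incr_n.
- apply Rabs_def2 in HN1; lra.
Qed.

(** The Taylor series in time, [g n] being the [n]-th time derivative at time [0]. *)
Definition generating_series (g : nat -> R3 -> R) (q : R4) : R :=
  PSeries (fun n => g n (fst q) / INR (fact n)) (snd q).

Definition entire_family (g : nat -> R3 -> R) : Prop :=
  exists b, entire b /\ eventually (fun n => forall p, Rabs (g n p) <= b n).

Lemma generating_series_convergence (g : nat -> R3 -> R) (T : R) :
  entire_family g ->
  (forall q : R4, Rabs (snd q) <= T ->
     ex_series (fun n => Rabs (g n (fst q) / INR (fact n) * snd q ^ n))) /\
  (forall eps, 0 < eps -> eventually (fun N => forall q : R4, Rabs (snd q) <= T ->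
     Rabs (sum_n (fun n => g n (fst q) / INR (fact n) * snd q ^ n) N
       - generating_series g q) < eps)).
Proof.
intros (b & Hb & N0 & HN0).
apply (weierstrass_m_test (fun q : R4 => Rabs (snd q) <= T)
  (fun n q => g n (fst q) / INR (fact n) * snd q ^ n) _ (entire_summable b T Hb)).
exists N0; intros n Hn q Hq.
unfold Rdiv; rewrite !Rabs_mult; apply Rmult_le_compat; try apply Rabs_pos.
- apply Rmult_le_pos; apply Rabs_pos.
- apply Rmult_le_compat_r; [apply Rabs_pos|].
  eapply Rle_trans; [apply HN0; auto|apply Rle_abs].
- rewrite <- !RPow_abs; apply pow_incr; split; [apply Rabs_pos|].
  eapply Rle_trans; [apply Hq|apply Rle_abs].
Qed.

Lemma generating_series_summable (g : nat -> R3 -> R) (p : R3) (theta : R) :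
  entire_family g -> ex_series (fun n => Rabs (g n p / INR (fact n) * theta ^ n)).
Proof.
intros Hg.
exact (proj1 (generating_series_convergence g (Rabs theta) Hg) (p, theta) (Rle_refl _)).
Qed.

Lemma generating_series_CV_radius (g : nat -> R3 -> R) (p : R3) :
  entire_family g -> CV_radius (fun n => g n p / INR (fact n)) = p_infty.
Proof.
intros Hg; apply CV_radius_infinite; intros x; now apply generating_series_summable.
Qed.

Lemma generating_series_time_derivative (g : nat -> R3 -> R) (p : R3) (theta : R) :
  entire_family g ->
  is_derive (fun t => generating_series g (p, t)) theta
    (generating_series (fun n => g (S n)) (p, theta)).
Proof.
intros Hg; unfold generating_series; simpl fst; simpl snd.
replace (PSeries (fun n => g (S n) p / INR (fact n)) theta) with
  (PSeries (PS_derive (fun n => g n p / INR (fact n))) theta).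
- apply is_derive_PSeries; rewrite generating_series_CV_radius; auto; exact I.
- apply PSeries_ext; intros n; unfold PS_derive.
  rewrite fact_simpl, mult_INR; field; split; [apply INR_fact_neq_0|now apply not_0_INR].
Qed.

Lemma generating_series_continuous (g : nat -> R3 -> R) :
  entire_family g -> (forall n p, continuous (g n) p) ->
  forall q, continuous (generating_series g) q.
Proof.
intros Hg Cg q0.
apply filterlim_locally; intros eps.
assert (He : 0 < eps / 3) by (generalize (cond_pos eps); lra).
destruct (proj2 (generating_series_convergence g (Rabs (snd q0) + 1) Hg) _ He) as (N & HN).
specialize (HN N (Nat.le_refl N)).
assert (Cs : continuous (fun q : R4 =>
  sum_n (fun n => g n (fst q) / INR (fact n) * snd q ^ n) N) q0).
{ clear HN; induction N as [|N IH].
  - apply continuous_ext with (fun q : R4 => g 0%nat (fst q) / INR (fact 0) * snd q ^ 0).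
    { intros q; now rewrite sum_O. }
    apply (continuous_mult (K := R_AbsRing)); [|apply continuous_const].
    apply (continuous_mult (K := R_AbsRing)); [|apply continuous_const].
    apply (continuous_comp fst (g 0%nat)); [apply continuous_fst|apply Cg].
  - apply continuous_ext with (fun q : R4 =>
      plus (sum_n (fun n => g n (fst q) / INR (fact n) * snd q ^ n) N)
        (g (S N) (fst q) / INR (fact (S N)) * snd q ^ S N)).
    { intros q; now rewrite sum_Sn. }
    apply (continuous_plus (V := R_NormedModule)); auto.
    apply (continuous_mult (K := R_AbsRing)).
    + apply (continuous_mult (K := R_AbsRing)); [|apply continuous_const].
      apply (continuous_comp fst (g (S N))); [apply continuous_fst|apply Cg].
    + apply (continuous_comp snd (fun t : R => t ^ S N)); [apply continuous_snd|].
      apply (ex_derive_continuous (V := R_NormedModule)); auto_derive; auto. }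
assert (H1 := proj1 (filterlim_locally _ _) Cs (mkposreal _ He)).
assert (H2 : locally q0 (fun q : R4 => Rabs (snd q) <= Rabs (snd q0) + 1)).
{ assert (Tri : forall s t : R, Rabs (s - t) < 1 -> Rabs s <= Rabs t + 1).
  { intros s t Hst; generalize (Rabs_triang_inv s t); lra. }
  exists posreal_one; intros q (_ & Hq); exact (Tri _ _ Hq). }
apply filter_imp with (2 := filter_and _ _ H1 H2); intros q (Hq1 & Hq2).
assert (Tri : forall a b c d : R, Rabs (c - d) < eps / 3 -> Rabs (c - a) < eps / 3 ->
  Rabs (d - b) < eps / 3 -> Rabs (a - b) < eps).
{ intros a b c d A1 A2 A3; apply Rabs_def2 in A1; apply Rabs_def2 in A2;
  apply Rabs_def2 in A3; apply Rabs_def1; lra. }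
exact (Tri _ _ _ _ Hq1 (HN q Hq2) (HN q0 (Rlt_le _ _ (Rlt_plus_1 _)))).
Qed.

(** Termwise differentiation: the differentiated partial sums also converge
    uniformly in space, by the majorant of the family of derivatives. *)
Lemma generating_series_space_derivative (g : nat -> R3 -> R) e (p : R3) (theta : R) :
  In e basis3 -> (forall n, smooth_scalar basis3 (g n)) ->
  entire_family g -> entire_family (fun n => partial e (g n)) ->
  is_derive (fun t => generating_series g (plus p (scal t e), theta)) 0
    (generating_series (fun n => partial e (g n)) (p, theta)).
Proof.
intros He Sg Hg Hpg.
set (term := fun n t => g n (plus p (scal t e)) / INR (fact n) * theta ^ n).
set (dterm := fun n t => partial e (g n) (plus p (scal t e)) / INR (fact n) * theta ^ n).
assert (D : forall n t, is_derive (term n) t (dterm n t)).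
{ intros n t; unfold term, dterm.
  assert (H := is_derive_along basis3 (g n) e p t He (Sg n)).
  assert (E : forall y, y / INR (fact n) * theta ^ n = theta ^ n / INR (fact n) * y)
    by (intros; unfold Rdiv; ring).
  rewrite E; apply is_derive_ext with (2 := is_derive_scal _ _ (theta ^ n / INR (fact n)) _ H).
  intros s; now rewrite E. }
assert (DS : forall N t, is_derive (fun t => sum_n (fun n => term n t) N) t
  (sum_n (fun n => dterm n t) N)).
{ intros N t; apply (is_derive_sum_n (V := R_NormedModule)); auto. }
assert (DE : forall N, Derive (fun t => sum_n (fun n => term n t) N) =
  (fun t => sum_n (fun n => dterm n t) N)).
{ intros N; apply functional_extensionality; intros t; now apply is_derive_unique. }
assert (G : is_derive (fun t : R => real (Lim_seq (fun N => sum_n (fun n => term n t) N))) 0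
  (real (Lim_seq (fun N => Derive (fun t => sum_n (fun n => term n t) N) 0)))).
{ apply (CVU_Derive (fun N t => sum_n (fun n => term n t) N) (fun _ => True)); auto.
  - apply open_true.
  - now intros x y z _ _ _.
  - intros eps.
    destruct (proj2 (generating_series_convergence g (Rabs theta) Hg) eps (cond_pos eps))
      as (N0 & HN0).
    exists N0; intros N HN t _.
    exact (HN0 N HN (plus p (scal t e), theta) (Rle_refl _)).
  - intros N t _; eexists; apply DS.
  - intros N t _; rewrite DE; apply continuity_pt_filterlim.
    assert (C : forall n, continuous (dterm n) t).
    { intros n; unfold dterm, Rdiv.
      do 2 (apply (continuous_mult (K := R_AbsRing)); [|apply continuous_const]).
      apply (ex_derive_continuous (V := R_NormedModule)); eexists.
      apply (is_derive_along basis3); auto; now apply smooth_scalar_partial. }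
    induction N as [|N IH].
    + apply continuous_ext with (dterm 0%nat); auto; intros; now rewrite sum_O.
    + apply continuous_ext with (fun t => plus (sum_n (fun n => dterm n t) N) (dterm (S N) t)).
      * intros; now rewrite sum_Sn.
      * now apply (continuous_plus (V := R_NormedModule)).
  - intros eps.
    destruct (proj2 (generating_series_convergence _ (Rabs theta) Hpg) eps (cond_pos eps))
      as (N0 & HN0).
    exists N0; intros N HN t _.
    rewrite (Lim_seq_ext _ (fun N => sum_n (fun n => dterm n t) N)) by (intros; now rewrite DE).
    rewrite DE.
    exact (HN0 N HN (plus p (scal t e), theta) (Rle_refl _)). }
assert (Ep : plus p (scal 0 e) = p) by exact (plus_scal_0 p e).
rewrite (Lim_seq_ext _ (sum_n (fun n => partial e (g n) p / INR (fact n) * theta ^ n))) in G.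
- exact G.
- intros N; rewrite DE; apply sum_n_ext; intros n.
  exact (f_equal (fun q => partial e (g n) q / INR (fact n) * theta ^ n) Ep).
Qed.

(** * Families of time derivatives of a solution of the wave equation *)

Definition laplacian (f : R3 -> R) (p : R3) : R :=
  partial e_x (partial e_x f) p + partial e_y (partial e_y f) p
  + partial e_z (partial e_z f) p.

(** The formal time derivatives at time [0] of a solution of the wave equation:
    each function is two time derivatives before its Laplacian. The point of the
    definition is that it is stable under time shifts and, by the gradient estimate,
    under space derivatives. *)
Definition wave_family (g : nat -> R3 -> R) : Prop :=
  (forall n, smooth_scalar basis3 (g n)) /\
  (forall n p, laplacian (g n) p = g (S (S n)) p) /\ entire_family g.

Lemma In_e_x : In e_x basis3. Proof. simpl; auto. Qed.
Lemma In_e_y : In e_y basis3. Proof. simpl; auto. Qed.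
Lemma In_e_z : In e_z basis3. Proof. simpl; auto. Qed.
#[local] Hint Resolve In_e_x In_e_y In_e_z : core.

Lemma partial_laplacian (f : R3 -> R) e :
  In e basis3 -> smooth_scalar basis3 f ->
  partial e (laplacian f) = laplacian (partial e f).
Proof.
intros He Hf.
assert (S1 : forall e1 e2, In e1 basis3 -> In e2 basis3 ->
  smooth_scalar basis3 (partial e2 (partial e1 f))).
{ intros e1 e2 H1 H2; repeat apply smooth_scalar_partial; auto. }
assert (Sp : forall a b : R3 -> R, smooth_scalar basis3 a -> smooth_scalar basis3 b ->
  smooth_scalar basis3 (fun q => a q + b q)).
{ intros a b Ha Hb k; apply class_C_plus; auto. }
unfold laplacian.
rewrite (partial_plus basis3) by auto.
rewrite (partial_plus basis3) by auto.
assert (C : forall e1, In e1 basis3 ->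
  partial e (partial e1 (partial e1 f)) = partial e1 (partial e1 (partial e f))).
{ intros e1 H1; rewrite (partial_comm basis3 e e1) by (auto; now apply smooth_scalar_partial).
  now rewrite (partial_comm basis3 e e1 f). }
now rewrite !C.
Qed.

Lemma wave_family_shift (g : nat -> R3 -> R) :
  wave_family g -> wave_family (fun n => g (S n)).
Proof.
intros (Sg & Lg & b & Hb & N & HN); repeat split; auto.
exists (fun n => b (S n)); split; [now apply entire_shift|].
exists N; intros n Hn; apply HN; lia.
Qed.

(** The Laplacian of [g n] is [g (n + 2)], whose majorant is a shift of that of [g];
    the gradient estimate then gives the majorant [3 b n + b (n + 2) / 2] for the
    derivatives, still entire. *)
Lemma wave_family_partial (g : nat -> R3 -> R) e :
  In e basis3 -> wave_family g -> wave_family (fun n => partial e (g n)).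
Proof.
intros He (Sg & Lg & b & Hb & N & HN); repeat split.
- intros n; now apply smooth_scalar_partial.
- intros n p; rewrite <- partial_laplacian by auto.
  f_equal; apply functional_extensionality; auto.
- exists (fun n => 3 * b n + / 2 * b (S (S n))); split.
  { apply entire_plus; apply entire_scal; auto.
    now apply (entire_shift (fun n => b (S n))), entire_shift. }
  exists N; intros n Hn p.
  assert (E : forall e1 e2, In e1 basis3 -> In e2 basis3 ->
    (forall q, partial e1 (partial e1 (g n)) q + partial e2 (partial e2 (g n)) q
      + partial e (partial e (g n)) q = laplacian (g n) q) ->
    Rabs (partial e (g n) p) <= 3 * b n + / 2 * b (S (S n))).
  { intros e1 e2 H1 H2 Hlap; rewrite (Rmult_comm (/ 2)).
    apply (interior_gradient_estimate basis3 (g n) e1 e2 e); auto.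
    intros q; rewrite Hlap, Lg; apply HN; lia. }
  destruct He as [<-|[<-|[<-|[]]]].
  + apply (E e_y e_z); auto; intros q; unfold laplacian; ring.
  + apply (E e_x e_z); auto; intros q; unfold laplacian; ring.
  + apply (E e_x e_y); auto.
Qed.

Lemma wave_family_space_derivative (g : nat -> R3 -> R) e p theta :
  In e basis3 -> wave_family g ->
  is_derive (fun t => generating_series g (plus p (scal t e), theta)) 0
    (generating_series (fun n => partial e (g n)) (p, theta)).
Proof.
intros He Hg; destruct (wave_family_partial g e He Hg) as (_ & _ & H2).
destruct Hg as (H0 & _ & H1).
now apply generating_series_space_derivative.
Qed.

(** A derivative of the series in space or in time is the series of another wave
    family, so continuity of all such series suffices. *)
Lemma wave_family_smooth (g : nat -> R3 -> R) :
  wave_family g -> smooth_scalar basis4 (generating_series g).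
Proof.
intros Hg k; revert g Hg; induction k as [|k IH]; intros g Hg.
- intros q; apply generating_series_continuous; [apply Hg|].
  intros n p; apply (smooth_scalar_continuous basis3), Hg.
- assert (Hspace : forall e, In e basis3 ->
    (forall q, ex_partial ((e, 0) : R4) (generating_series g) q) /\
    class_C basis4 k (partial ((e, 0) : R4) (generating_series g))).
  { intros e He.
    assert (D : forall q, is_derive (fun t => generating_series g (plus q (scal t ((e, 0) : R4)))) 0
      (generating_series (fun n => partial e (g n)) q)).
    { intros [p theta].
      apply is_derive_ext with (2 := wave_family_space_derivative g e p theta He Hg).
      intros t; f_equal; apply (f_equal2 pair); auto.
      change (theta = theta + t * 0); rewrite Rmult_0_r, Rplus_0_r; reflexivity. }
    split.
    - intros q; eexists; apply D.
    - replace (partial ((e, 0) : R4) (generating_series g)) with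
        (generating_series (fun n => partial e (g n))).
      + now apply IH, wave_family_partial.
      + apply functional_extensionality; intros q; symmetry; apply is_derive_unique, D. }
  assert (Htime : (forall q, ex_partial (((0, 0, 0), 1) : R4) (generating_series g) q) /\
    class_C basis4 k (partial (((0, 0, 0), 1) : R4) (generating_series g))).
  { assert (D : forall q, is_derive
      (fun t => generating_series g (plus q (scal t (((0, 0, 0), 1) : R4)))) 0
      (generating_series (fun n => g (S n)) q)).
    { intros [p theta].
      assert (H := generating_series_time_derivative g p theta (proj2 (proj2 Hg))).
      assert (Hs : is_derive (fun t => theta + t) 0 1) by (auto_derive; auto).
      rewrite <- (Rplus_0_r theta) in H at 1.
      assert (H' := is_derive_comp _ (fun t => theta + t) 0 _ _ H Hs).
      replace (generating_series (fun n => g (S n)) (p, theta)) with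
        (scal 1 (generating_series (fun n => g (S n)) (p, theta))) by apply Rmult_1_l.
      apply is_derive_ext with (2 := H').
      intros t; f_equal; destruct p as [[x y] z].
      change ((x, y, z, theta + t) =
        (x + t * 0, y + t * 0, z + t * 0, theta + t * 1)).
      rewrite Rmult_0_r, !Rplus_0_r, Rmult_1_r; auto. }
    split.
    - intros q; eexists; apply D.
    - replace (partial (((0, 0, 0), 1) : R4) (generating_series g)) with
        (generating_series (fun n => g (S n))).
      + now apply IH, wave_family_shift.
      + apply functional_extensionality; intros q; symmetry; apply is_derive_unique, D. }
  intros e [<-|[<-|[<-|[<-|[]]]]]; [apply Hspace|apply Hspace|apply Hspace|exact Htime]; auto.
Qed.

(** * Vector fields by coordinates *)

Definition coordinates : list (R3 -> R) := [cx; cy; cz].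

Lemma In_cx : In cx coordinates. Proof. simpl; auto. Qed.
Lemma In_cy : In cy coordinates. Proof. simpl; auto. Qed.
Lemma In_cz : In cz coordinates. Proof. simpl; auto. Qed.
#[local] Hint Resolve In_cx In_cy In_cz : core.

Lemma coordinate_plus c (u v : R3) : In c coordinates -> c (plus u v) = c u + c v.
Proof. intros [<-|[<-|[<-|[]]]]; reflexivity. Qed.

Lemma coordinate_scal c k (v : R3) : In c coordinates -> c (scal k v) = k * c v.
Proof. intros [<-|[<-|[<-|[]]]]; reflexivity. Qed.

Lemma coordinate_vsum c a p theta : In c coordinates ->
  c (vsum a p theta) = Series (fun n => c (a n p theta)).
Proof. intros [<-|[<-|[<-|[]]]]; reflexivity. Qed.

Lemma R3_ext (u v : R3) : (forall c, In c coordinates -> c u = c v) -> u = v.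
Proof.
intros H; destruct u as [[u1 u2] u3], v as [[v1 v2] v3].
generalize (H cx In_cx) (H cy In_cy) (H cz In_cz).
unfold cx, cy, cz; simpl; intros -> -> ->; reflexivity.
Qed.

Lemma coordinate_le_norm c (v : R3) : In c coordinates -> Rabs (c v) <= norm v.
Proof.
intros Hc; rewrite norm_R3, <- sqrt_Rsqr_abs; apply sqrt_le_1_alt; unfold Rsqr.
generalize (pow2_ge_0 (cx v)) (pow2_ge_0 (cy v)) (pow2_ge_0 (cz v)).
destruct Hc as [<-|[<-|[<-|[]]]]; lra.
Qed.

Lemma norm_le_coordinates (v : R3) : norm v <= Rabs (cx v) + Rabs (cy v) + Rabs (cz v).
Proof.
generalize (Rabs_pos (cx v)) (Rabs_pos (cy v)) (Rabs_pos (cz v)); intros.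
rewrite norm_R3, <- (pow2_abs (cx v)), <- (pow2_abs (cy v)), <- (pow2_abs (cz v)).
rewrite <- (sqrt_Rsqr (Rabs (cx v) + Rabs (cy v) + Rabs (cz v))) by lra.
apply sqrt_le_1_alt; unfold Rsqr.
assert (0 <= Rabs (cx v) * Rabs (cy v)) by now apply Rmult_le_pos.
assert (0 <= Rabs (cx v) * Rabs (cz v)) by now apply Rmult_le_pos.
assert (0 <= Rabs (cy v) * Rabs (cz v)) by now apply Rmult_le_pos.
lra.
Qed.

Lemma smooth_coordinates {V : NormedModule R_AbsRing} (B : list V) (F : V -> R3) :
  smooth B F <-> forall c, In c coordinates -> smooth_scalar B (fun p => c (F p)).
Proof.
split.
- intros HF c [<-|[<-|[<-|[]]]] k; apply (HF k).
- intros HF k; repeat split; apply (HF _); auto.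
Qed.

Lemma smooth_scal {V : NormedModule R_AbsRing} (B : list V) (F : V -> R3) k :
  smooth B F -> smooth B (fun p => scal k (F p)).
Proof.
rewrite !smooth_coordinates; intros HF c Hc n.
replace (fun p => c (scal k (F p))) with (fun p => k * c (F p)).
- now apply class_C_scal, HF.
- apply functional_extensionality; intros p; now rewrite coordinate_scal.
Qed.

Lemma smooth_curl (F : R3 -> R3) : smooth basis3 F -> smooth basis3 (curl F).
Proof.
rewrite smooth_coordinates; intros HF k.
repeat split; apply class_C_minus;
  apply (smooth_scalar_partial basis3); auto.
Qed.

(** * Vector calculus identities *)

Lemma partial_coordinate_scal (F : R3 -> R3) c e k p : In c coordinates ->
  partial e (fun q => c (scal k (F q))) p = k * partial e (fun q => c (F q)) p.
Proof.
intros Hc; unfold partial; rewrite <- Derive_scal; apply Derive_ext; intros t.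
now apply coordinate_scal.
Qed.

Lemma curl_scal (F : R3 -> R3) k :
  curl (fun p => scal k (F p)) = (fun p => scal k (curl F p)).
Proof.
apply functional_extensionality; intros p; unfold curl.
rewrite !partial_coordinate_scal by auto.
change (scal k (?a, ?b, ?c) : R3) with ((k * a, k * b, k * c) : R3).
now rewrite !Rmult_minus_distr_l.
Qed.

Lemma divergence_scal (F : R3 -> R3) k p :
  divergence (fun q => scal k (F q)) p = k * divergence F p.
Proof. unfold divergence; rewrite !partial_coordinate_scal by auto; ring. Qed.

Lemma partial_curl_entry (F : R3 -> R3) p : smooth basis3 F ->
  forall e c1 e1 c2 e2, In e basis3 -> In c1 coordinates -> In e1 basis3 ->
  In c2 coordinates -> In e2 basis3 ->
  partial e (fun q => partial e1 (fun q => c1 (F q)) q - partial e2 (fun q => c2 (F q)) q) p =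
  partial e (partial e1 (fun q => c1 (F q))) p - partial e (partial e2 (fun q => c2 (F q))) p.
Proof.
rewrite smooth_coordinates; intros HF e c1 e1 c2 e2 He H1 He1 H2 He2.
rewrite (partial_minus basis3); auto; apply smooth_scalar_partial; auto.
Qed.

Lemma divergence_curl (F : R3 -> R3) p : smooth basis3 F -> divergence (curl F) p = 0.
Proof.
intros HF; assert (M := partial_curl_entry F p HF); rewrite smooth_coordinates in HF.
change (
  partial e_x (fun q => partial e_y (fun q => cz (F q)) q - partial e_z (fun q => cy (F q)) q) p
  + partial e_y (fun q => partial e_z (fun q => cx (F q)) q - partial e_x (fun q => cz (F q)) q) p
  + partial e_z (fun q => partial e_x (fun q => cy (F q)) q - partial e_y (fun q => cx (F q)) q) p
  = 0).
rewrite !M by auto.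
rewrite (partial_comm basis3 e_x e_y), (partial_comm basis3 e_x e_z),
  (partial_comm basis3 e_y e_z) by (try apply HF; auto).
ring.
Qed.

(** curl curl = grad div - Laplacian. *)
Lemma curl_curl (F : R3 -> R3) c p :
  smooth basis3 F -> (forall q, divergence F q = 0) -> In c coordinates ->
  c (curl (curl F) p) = - laplacian (fun q => c (F q)) p.
Proof.
intros HF Hdiv; assert (M := partial_curl_entry F p HF); rewrite smooth_coordinates in HF.
assert (S : forall c e, In c coordinates -> In e basis3 ->
  smooth_scalar basis3 (partial e (fun q => c (F q)))).
{ intros c' e Hc He; now apply smooth_scalar_partial; [|apply HF]. }
assert (G : forall e, In e basis3 ->
  partial e (partial e_x (fun q => cx (F q))) p +
  partial e (partial e_y (fun q => cy (F q))) p +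
  partial e (partial e_z (fun q => cz (F q))) p = 0).
{ intros e He.
  transitivity (partial e (divergence F) p).
  - unfold divergence.
    rewrite (partial_plus basis3), (partial_plus basis3); auto.
    intros k; apply class_C_plus; apply S; auto.
  - unfold partial; rewrite (Derive_ext _ (fun _ => 0)) by (intros; apply Hdiv).
    apply Derive_const. }
assert (Gx := G e_x In_e_x); assert (Gy := G e_y In_e_y); assert (Gz := G e_z In_e_z).
rewrite (partial_comm basis3 e_x e_y), (partial_comm basis3 e_x e_z) in Gx
  by (try apply HF; auto).
rewrite (partial_comm basis3 e_y e_x), (partial_comm basis3 e_y e_z) in Gy
  by (try apply HF; auto).
rewrite (partial_comm basis3 e_z e_x), (partial_comm basis3 e_z e_y) in Gz
  by (try apply HF; auto).
intros Hc.
change (laplacian (fun q => c (F q)) p) with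
  (partial e_x (partial e_x (fun q => c (F q))) p
   + partial e_y (partial e_y (fun q => c (F q))) p
   + partial e_z (partial e_z (fun q => c (F q))) p).
assert (E : curl (curl F) p =
  (partial e_y (fun q => partial e_x (fun q => cy (F q)) q - partial e_y (fun q => cx (F q)) q) p
   - partial e_z (fun q => partial e_z (fun q => cx (F q)) q - partial e_x (fun q => cz (F q)) q) p,
   partial e_z (fun q => partial e_y (fun q => cz (F q)) q - partial e_z (fun q => cy (F q)) q) p
   - partial e_x (fun q => partial e_x (fun q => cy (F q)) q - partial e_y (fun q => cx (F q)) q) p,
   partial e_x (fun q => partial e_z (fun q => cx (F q)) q - partial e_x (fun q => cz (F q)) q) p
   - partial e_y (fun q => partial e_y (fun q => cz (F q)) q - partial e_z (fun q => cy (F q)) q) p))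
  by reflexivity.
rewrite E, !M by auto; clear E.
destruct Hc as [<-|[<-|[<-|[]]]].
- match goal with |- cx (?u, _, _) = _ => change (cx (u, _, _)) with u end; lra.
- match goal with |- cy (_, ?u, _) = _ => change (cy (_, u, _)) with u end; lra.
- match goal with |- cz (_, _, ?u) = _ => change (cz (_, _, u)) with u end; lra.
Qed.

(** * Time derivatives of the fields at time zero *)

(** For fields with [H' = a curl E] and [E' = b curl H], the [n]-th time derivative
    of [H] when [U] and [V] are the initial values of [H] and [E]. Each step
    exchanges the two fields, so one definition serves both. *)
Fixpoint maxwell_coeff (a b : R) (U V : R3 -> R3) (n : nat) : R3 -> R3 :=
  match n with
  | O => U
  | S m => fun p => scal a (curl (maxwell_coeff b a V U m) p)
  end.

Lemma maxwell_coeff_smooth a b U V n :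
  smooth basis3 U -> smooth basis3 V -> smooth basis3 (maxwell_coeff a b U V n).
Proof.
revert a b U V; induction n as [|n IH]; intros a b U V HU HV; simpl; auto.
now apply smooth_scal, smooth_curl, IH.
Qed.

Lemma maxwell_coeff_divergence a b U V n p :
  smooth basis3 U -> smooth basis3 V -> (forall q, divergence U q = 0) ->
  divergence (maxwell_coeff a b U V n) p = 0.
Proof.
intros HU HV HdU; destruct n as [|n]; simpl; auto.
rewrite divergence_scal, divergence_curl; [ring|now apply maxwell_coeff_smooth].
Qed.

Lemma maxwell_coeff_SS a b U V n :
  maxwell_coeff a b U V (S (S n)) =
  (fun p => scal (a * b) (curl (curl (maxwell_coeff a b U V n)) p)).
Proof.
simpl; rewrite curl_scal; apply functional_extensionality; intros p.
now rewrite scal_assoc.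
Qed.

(** Two steps apply [a b] curl curl, which is the Laplacian on divergence-free
    fields because [a b = -1]. *)
Lemma maxwell_coeff_wave a b U V n c p :
  a * b = -1 -> smooth basis3 U -> smooth basis3 V -> (forall q, divergence U q = 0) ->
  In c coordinates ->
  laplacian (fun q => c (maxwell_coeff a b U V n q)) p = c (maxwell_coeff a b U V (S (S n)) p).
Proof.
intros Hab HU HV HdU Hc.
rewrite maxwell_coeff_SS, coordinate_scal, Hab, curl_curl by
  (auto using maxwell_coeff_smooth, maxwell_coeff_divergence).
ring.
Qed.

Lemma maxwell_coeff_even a b U V m :
  maxwell_coeff a b U V (2 * m) = (fun p => scal ((a * b) ^ m) (curl_iter (2 * m) U p)).
Proof.
induction m as [|m IH].
- apply functional_extensionality; intros p; apply R3_ext; intros c Hc.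
  rewrite coordinate_scal by auto; symmetry; apply Rmult_1_l.
- replace (2 * S m)%nat with (S (S (2 * m))) by lia.
  rewrite maxwell_coeff_SS, IH, !curl_scal.
  apply functional_extensionality; intros p; now rewrite scal_assoc.
Qed.

Lemma maxwell_coeff_odd a b U V m :
  maxwell_coeff a b U V (2 * m + 1) =
  (fun p => scal (a * (a * b) ^ m) (curl_iter (2 * m + 1) V p)).
Proof.
replace (2 * m + 1)%nat with (S (2 * m)) by lia.
change (maxwell_coeff a b U V (S (2 * m))) with
  (fun p => scal a (curl (maxwell_coeff b a V U (2 * m)) p)).
rewrite (maxwell_coeff_even b a), curl_scal, (Rmult_comm b a).
apply functional_extensionality; intros p; now rewrite scal_assoc.
Qed.

(** * Convergence of the curl series *)

(** The quotient of consecutive terms divided by factorials is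
    [A (n + 1) ^ (beta - 1)], which tends to [0] because [beta < 1]. *)
Lemma entire_growth (C A beta : R) :
  0 < C -> 0 < A -> beta < 1 ->
  entire (fun n => C * A ^ n * Rpower (INR (fact n)) beta).
Proof.
intros HC HA Hbeta.
assert (Hpos : forall n, 0 < C * A ^ n * Rpower (INR (fact n)) beta / INR (fact n)).
{ intros n; apply Rdiv_lt_0_compat; [|apply INR_fact_lt_0].
  repeat apply Rmult_lt_0_compat; auto; [now apply pow_lt|apply exp_pos]. }
apply CV_radius_infinite_DAlembert.
{ intros n; apply Rgt_not_eq, Hpos. }
apply is_lim_seq_ext with (fun n => A * exp ((beta - 1) * ln (INR (S n)))).
- intros n; rewrite Rabs_pos_eq by (apply Rlt_le, Rdiv_lt_0_compat; apply Hpos).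
  assert (HS : 0 < INR (S n)) by (apply lt_0_INR; lia).
  assert (HF := INR_fact_lt_0 n).
  rewrite fact_simpl, mult_INR, <- Rpower_mult_distr by auto.
  assert (HR : 0 < Rpower (INR (fact n)) beta) by apply exp_pos.
  assert (HA' : 0 < A ^ n) by now apply pow_lt.
  replace ((beta - 1) * ln (INR (S n))) with (beta * ln (INR (S n)) + - ln (INR (S n))) by ring.
  rewrite exp_plus, exp_Ropp, exp_ln by auto.
  change (exp (beta * ln (INR (S n)))) with (Rpower (INR (S n)) beta).
  change (A ^ S n) with (A * A ^ n).
  field; repeat split; apply Rgt_not_eq; auto.
- replace (Finite 0) with (Rbar_mult A 0) by (simpl; f_equal; ring).
  apply is_lim_seq_scal_l.
  apply (is_lim_comp_seq exp _ m_infty).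
  + apply is_lim_exp_m.
  + exists 0%nat; now intros.
  + replace m_infty with (Rbar_mult (beta - 1) p_infty).
    * apply is_lim_seq_scal_l.
      apply (is_lim_comp_seq ln _ p_infty); [apply is_lim_ln_p|exists 0%nat; now intros|].
      apply (is_lim_seq_incr_1 INR), is_lim_seq_INR.
    * simpl; destruct Rle_dec as [H|H]; [exfalso; lra|auto].
Qed.

Lemma sum_n_coordinate c (a : nat -> R3) N : In c coordinates ->
  c (sum_n a N) = sum_n (fun n => c (a n)) N.
Proof.
intros Hc; induction N as [|N IH]; [now rewrite !sum_O|].
now rewrite !sum_Sn, coordinate_plus, IH.
Qed.

Lemma half_pow_antitone n m : (n <= m)%nat -> (1 / 2) ^ m <= (1 / 2) ^ n.
Proof.
intros H; replace m with (n + (m - n))%nat by lia; rewrite pow_add.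
rewrite <- (Rmult_1_r ((1 / 2) ^ n)) at 2.
apply Rmult_le_compat_l; [apply pow_le; lra|].
apply Rle_trans with (1 ^ (m - n)); [apply pow_incr; lra|rewrite pow1; lra].
Qed.

Lemma ex_series_half K : ex_series (fun n => K * (1 / 2) ^ n).
Proof.
apply (ex_series_scal (V := R_NormedModule)), ex_series_geom.
rewrite Rabs_pos_eq; lra.
Qed.

(** Stated for arbitrary indices [k n >= n] because the four series are even and odd
    subseries with various signs. *)
Lemma curl_terms_converge (s k : nat -> nat) (C A beta : R) (F : R3 -> R3) :
  (forall n, (n <= k n)%nat) ->
  0 < C -> 0 < A -> beta < 1 -> curl_growth C A beta F ->
  converges_absolutely (fun n => curl_term (s n) (k n) F) /\
  converges_uniformly_on_compacts (fun n => curl_term (s n) (k n) F).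
Proof.
intros Hk HC HA Hbeta (N0 & HN0).
assert (Bound : forall T, exists K, forall n, (N0 <= n)%nat -> forall q : R4, Rabs (snd q) <= T ->
  norm (curl_term (s n) (k n) F (fst q) (snd q)) <= K * (1 / 2) ^ n).
{ intros T.
  destruct (entire_geometric _ T (entire_growth C A beta HC HA Hbeta)) as (K & HK0 & HK).
  exists K; intros n Hn q Hq.
  apply Rle_trans with (K * (1 / 2) ^ k n).
  2: { apply Rmult_le_compat_l; auto; now apply half_pow_antitone. }
  eapply Rle_trans; [|apply HK].
  eapply Rle_trans; [exact (norm_scal ((-1) ^ s n * (snd q ^ k n / INR (fact (k n))))
    (curl_iter (k n) F (fst q)))|].
  change (abs ((-1) ^ s n * (snd q ^ k n / INR (fact (k n))))) with
    (Rabs ((-1) ^ s n * (snd q ^ k n / INR (fact (k n))))).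
  rewrite Rabs_mult, pow_1_abs, Rmult_1_l.
  assert (Hf := INR_fact_lt_0 (k n)).
  specialize (HN0 (k n) ltac:(specialize (Hk n); lia) (fst q)).
  assert (HT : 0 <= T) by (eapply Rle_trans; [apply Rabs_pos|apply Hq]).
  rewrite (Rabs_pos_eq (_ / _ * _)).
  - unfold Rdiv; rewrite Rabs_mult, (Rabs_pos_eq (/ _)) by (now apply Rlt_le, Rinv_0_lt_compat).
    rewrite <- RPow_abs.
    apply Rle_trans with (T ^ k n * / INR (fact (k n)) *
      (C * A ^ k n * Rpower (INR (fact (k n))) beta)); [|right; ring].
    apply Rmult_le_compat; auto.
    + apply Rmult_le_pos; [apply pow_le, Rabs_pos|now apply Rlt_le, Rinv_0_lt_compat].
    + apply norm_ge_0.
    + apply Rmult_le_compat_r; [now apply Rlt_le, Rinv_0_lt_compat|].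
      apply pow_incr; split; auto; apply Rabs_pos.
  - apply Rmult_le_pos; [|now apply pow_le].
    apply Rmult_le_pos; [|now apply Rlt_le, Rinv_0_lt_compat].
    apply Rle_trans with (2 := HN0), norm_ge_0. }
split.
- intros p theta; destruct (Bound (Rabs theta)) as (K & HK).
  assert (H := proj1 (weierstrass_m_test (fun q : R4 => Rabs (snd q) <= Rabs theta)
    (fun n q => norm (curl_term (s n) (k n) F (fst q) (snd q))) _ (ex_series_half K)
    (ex_intro _ N0 (fun n Hn q Hq => eq_ind_r (fun x => x <= _) (HK n Hn q Hq)
       (Rabs_pos_eq _ (norm_ge_0 _))))) (p, theta) (Rle_refl _)).
  apply ex_series_ext with (2 := H); intros n; apply Rabs_pos_eq, norm_ge_0.
- intros t1 t2 eps Heps.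
  destruct (Bound (Rmax (Rabs t1) (Rabs t2))) as (K & HK).
  assert (W : forall c, In c coordinates -> eventually (fun N => forall q : R4,
    Rabs (snd q) <= Rmax (Rabs t1) (Rabs t2) ->
    Rabs (sum_n (fun n => c (curl_term (s n) (k n) F (fst q) (snd q))) N -
      Series (fun n => c (curl_term (s n) (k n) F (fst q) (snd q)))) < eps / 3)).
  { intros c Hc.
    apply (proj2 (weierstrass_m_test (fun q : R4 => Rabs (snd q) <= Rmax (Rabs t1) (Rabs t2))
      (fun n q => c (curl_term (s n) (k n) F (fst q) (snd q))) _ (ex_series_half K)
      (ex_intro _ N0 (fun n Hn q Hq => Rle_trans _ _ _ (coordinate_le_norm c _ Hc)
         (HK n Hn q Hq))))); lra. }
  apply filter_imp with (2 := filter_and _ _ (W cx In_cx)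
    (filter_and _ _ (W cy In_cy) (W cz In_cz))).
  intros N (Wx & Wy & Wz) p theta Ht.
  assert (Hq : Rabs theta <= Rmax (Rabs t1) (Rabs t2)) by now apply RmaxAbs.
  specialize (Wx (p, theta) Hq); specialize (Wy (p, theta) Hq); specialize (Wz (p, theta) Hq).
  eapply Rle_lt_trans; [apply norm_le_coordinates|].
  assert (E : forall c, In c coordinates ->
    c (minus (sum_n (fun n => curl_term (s n) (k n) F p theta) N)
       (vsum (fun n => curl_term (s n) (k n) F) p theta)) =
    sum_n (fun n => c (curl_term (s n) (k n) F p theta)) N -
      Series (fun n => c (curl_term (s n) (k n) F p theta))).
  { intros c Hc; rewrite <- (sum_n_coordinate c (fun n => curl_term (s n) (k n) F p theta)) by auto.
    destruct Hc as [<-|[<-|[<-|[]]]]; reflexivity. }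
  rewrite (E cx In_cx), (E cy In_cy), (E cz In_cz).
  assert (Add : forall x y z, x < eps / 3 -> y < eps / 3 -> z < eps / 3 -> x + y + z < eps)
    by (intros; lra).
  exact (Add _ _ _ Wx Wy Wz).
Qed.

(** * The fields as Taylor series in time *)

Definition generating_field (u : nat -> R3 -> R3) (q : R4) : R3 :=
  (generating_series (fun n p => cx (u n p)) q,
   generating_series (fun n p => cy (u n p)) q,
   generating_series (fun n p => cz (u n p)) q).

Lemma coordinate_generating_field c u q : In c coordinates ->
  c (generating_field u q) = generating_series (fun n p => c (u n p)) q.
Proof. intros [<-|[<-|[<-|[]]]]; reflexivity. Qed.

Lemma maxwell_coeff_growth (a b C A beta : R) U V c :
  a * b = -1 -> 0 < C -> 0 < A -> beta < 1 ->
  curl_growth C A beta U -> curl_growth C A beta V -> In c coordinates ->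
  entire_family (fun n p => c (maxwell_coeff a b U V n p)).
Proof.
intros Hab HC HA Hbeta HU HV Hc.
exists (fun n => (1 + Rabs a) * (C * A ^ n * Rpower (INR (fact n)) beta)); split.
{ now apply entire_scal, entire_growth. }
apply filter_imp with (2 := filter_and _ _ HU HV); intros n (Un & Vn) p.
assert (S : forall r W, Rabs r <= 1 + Rabs a ->
  norm (curl_iter n W p) <= C * A ^ n * Rpower (INR (fact n)) beta ->
  Rabs (c (scal r (curl_iter n W p))) <=
    (1 + Rabs a) * (C * A ^ n * Rpower (INR (fact n)) beta)).
{ intros r W Hr HW; rewrite coordinate_scal, Rabs_mult by auto.
  apply Rmult_le_compat; auto; try apply Rabs_pos.
  eapply Rle_trans; [now apply coordinate_le_norm|exact HW]. }
assert (H1 := Rabs_pos a).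
destruct (Nat.Even_or_Odd n) as [[m ->]|[m ->]].
- rewrite maxwell_coeff_even, Hab; apply S; auto; rewrite pow_1_abs; lra.
- rewrite maxwell_coeff_odd, Hab; apply S; auto; rewrite Rabs_mult, pow_1_abs; lra.
Qed.

Lemma maxwell_coeff_wave_family (a b C A beta : R) U V c :
  a * b = -1 -> smooth basis3 U -> smooth basis3 V -> (forall q, divergence U q = 0) ->
  0 < C -> 0 < A -> beta < 1 ->
  curl_growth C A beta U -> curl_growth C A beta V -> In c coordinates ->
  wave_family (fun n p => c (maxwell_coeff a b U V n p)).
Proof.
intros Hab HU HV HdU HC HA Hbeta GU GV Hc; repeat split.
- intros n; apply smooth_coordinates; auto; now apply maxwell_coeff_smooth.
- intros n p; now apply maxwell_coeff_wave.
- now apply (maxwell_coeff_growth a b C A beta).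
Qed.

Lemma entire_family_subseries (g : nat -> R3 -> R) (k : nat -> nat) p theta :
  (forall n, (n <= k n)%nat) -> entire_family g ->
  ex_series (fun n => g (k n) p / INR (fact (k n)) * theta ^ k n).
Proof.
intros Hk (b & Hb & N0 & HN0).
destruct (entire_geometric b theta Hb) as (K & HK0 & HK).
apply ex_series_Rabs.
apply (weierstrass_m_test (fun _ : unit => True)
  (fun n _ => g (k n) p / INR (fact (k n)) * theta ^ k n) _ (ex_series_half K)); [|exact tt|exact I].
exists N0; intros n Hn _ _.
apply Rle_trans with (K * (1 / 2) ^ k n).
2: { apply Rmult_le_compat_l; auto; now apply half_pow_antitone. }
eapply Rle_trans; [|apply HK].
unfold Rdiv; rewrite !Rabs_mult; repeat (apply Rmult_le_compat_r; [apply Rabs_pos|]).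
eapply Rle_trans; [apply HN0; specialize (Hk n); lia|apply Rle_abs].
Qed.

(** Time derivatives of even order come from [U] and those of odd order from [V], so
    the four series regroup into one Taylor series in time. *)
Lemma even_odd_expansion (a b : R) U V p theta :
  a * b = -1 ->
  (forall c, In c coordinates -> entire_family (fun n p => c (maxwell_coeff a b U V n p))) ->
  plus (plus (U p) (vsum (even_terms U) p theta)) (scal a (vsum (odd_terms_E V) p theta)) =
  generating_field (maxwell_coeff a b U V) (p, theta).
Proof.
intros Hab Hent; apply R3_ext; intros c Hc.
rewrite !coordinate_plus, coordinate_scal, !coordinate_vsum, coordinate_generating_field by auto.
unfold generating_series; simpl fst; simpl snd.
set (al := fun n => c (maxwell_coeff a b U V n p) / INR (fact n)).
assert (Sub : forall k : nat -> nat, (forall n, (n <= k n)%nat) ->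
  ex_series (fun n => al (k n) * theta ^ k n)).
{ intros k Hk; exact (entire_family_subseries _ k p theta Hk (Hent c Hc)). }
assert (E2 : forall n, theta ^ (2 * n) = (theta ^ 2) ^ n) by (intros; apply pow_mult).
assert (E3 : forall n, theta ^ (2 * n + 1) = theta * (theta ^ 2) ^ n)
  by (intros; rewrite pow_add, E2; ring).
assert (Even : ex_series (fun n => al (2 * n)%nat * (theta ^ 2) ^ n)).
{ apply ex_series_ext with (2 := Sub (fun n => 2 * n)%nat ltac:(cbv beta; intros; lia)).
  intros n; now rewrite E2. }
assert (Odd : ex_series (fun n => al (2 * n + 1)%nat * (theta ^ 2) ^ n)).
{ destruct (Req_dec theta 0) as [->|Ht].
  - apply ex_series_incr_1, ex_series_ext with (fun _ => 0).
    + intros n; simpl; ring.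
    + exists 0; apply filterlim_ext with (fun _ => 0); [|apply filterlim_const].
      intros n; symmetry; rewrite sum_n_const; ring.
  - apply ex_series_ext with (fun n => scal (/ theta) (al (2 * n + 1)%nat * theta ^ (2 * n + 1))).
    + intros n; rewrite E3; change (/ theta * (al (2 * n + 1)%nat * (theta * (theta ^ 2) ^ n)) =
        al (2 * n + 1)%nat * (theta ^ 2) ^ n); field; auto.
    + apply (ex_series_scal (V := R_NormedModule)), (Sub (fun n => 2 * n + 1)%nat); intros; lia. }
transitivity (PSeries al theta); [|reflexivity].
rewrite PSeries_odd_even by (apply (proj2 (ex_pseries_R _ _)); assumption).
unfold PSeries at 1; rewrite (Series_incr_1 _ Even).
unfold PSeries; rewrite <- !Series_scal_l.
f_equal; [f_equal|].
- unfold al; simpl; field.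
- apply Series_ext; intros n.
  unfold even_terms, curl_term, al; rewrite coordinate_scal by auto.
  rewrite <- E2, (maxwell_coeff_even a b), Hab, coordinate_scal by auto.
  replace (n + 1)%nat with (S n) by lia; field; apply INR_fact_neq_0.
- apply Series_ext; intros n.
  unfold odd_terms_E, curl_term, al; rewrite coordinate_scal by auto.
  rewrite (maxwell_coeff_odd a b), Hab, E3, coordinate_scal by auto.
  field; apply INR_fact_neq_0.
Qed.

Lemma is_derive_pair {U V : NormedModule R_AbsRing} (f : R -> U) (g : R -> V) t l m :
  is_derive f t l -> is_derive g t m ->
  is_derive (fun s => (f s, g s) : prod_NormedModule R_AbsRing U V) t (l, m).
Proof.
intros Hf Hg.
apply (filterdiff_comp_2 f g (fun a b => (a, b) : prod_NormedModule R_AbsRing U V)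
  (fun y => scal y l) (fun y => scal y m) (fun a b => (a, b))); auto.
apply filterdiff_linear, is_linear_prod; [apply is_linear_fst|apply is_linear_snd].
Qed.

Lemma is_derive_coordinates (f : R -> R3) t l :
  (forall c, In c coordinates -> is_derive (fun s => c (f s)) t (c l)) -> is_derive f t l.
Proof.
intros H.
apply is_derive_ext with (fun s => (cx (f s), cy (f s), cz (f s)) : R3).
{ intros s; now destruct (f s) as [[]]. }
replace l with ((cx l, cy l, cz l) : R3) by now destruct l as [[]].
apply (is_derive_pair (V := R_NormedModule) (fun s => (cx (f s), cy (f s)))); auto.
apply (is_derive_pair (U := R_NormedModule) (V := R_NormedModule)); auto.
Qed.

Lemma generating_series_scal_minus (f g : nat -> R3 -> R) a q :
  entire_family f -> entire_family g ->
  generating_series (fun n p => a * (f n p - g n p)) q =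
  a * (generating_series f q - generating_series g q).
Proof.
intros Hf Hg; destruct q as [p theta]; unfold generating_series, PSeries; simpl fst; simpl snd.
rewrite <- Series_minus, <- Series_scal_l.
- apply Series_ext; intros n; unfold Rdiv; ring.
- now apply ex_series_Rabs, generating_series_summable.
- now apply ex_series_Rabs, generating_series_summable.
Qed.

(** Differentiating in time shifts the family [u]; differentiating in space acts on
    each member of [v]; the recursion relates the two. *)
Lemma generating_field_evolution (u v : nat -> R3 -> R3) a p theta :
  (forall n, u (S n) = (fun p => scal a (curl (v n) p))) ->
  (forall c, In c coordinates -> wave_family (fun n p => c (u n p))) ->
  (forall c, In c coordinates -> wave_family (fun n p => c (v n p))) ->
  is_derive (fun t => generating_field u (p, t)) theta
    (scal a (curl (fun q => generating_field v (q, theta)) p)).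
Proof.
intros Huv Hu Hv; apply is_derive_coordinates; intros c Hc.
assert (P : forall c e, In c coordinates -> In e basis3 ->
  partial e (fun q => c (generating_field v (q, theta))) p =
  generating_series (fun n => partial e (fun p => c (v n p))) (p, theta)).
{ intros c' e Hc' He.
  apply is_derive_unique.
  apply is_derive_ext with
    (2 := wave_family_space_derivative _ e p theta He (Hv c' Hc')).
  intros t; now rewrite coordinate_generating_field. }
assert (W : forall c e, In c coordinates -> In e basis3 ->
  entire_family (fun n => partial e (fun p => c (v n p)))).
{ intros c' e Hc' He; exact (proj2 (proj2 (wave_family_partial _ e He (Hv c' Hc')))). }
assert (E : c (scal a (curl (fun q => generating_field v (q, theta)) p)) =
  generating_series (fun n p => c (u (S n) p)) (p, theta)).
{ rewrite coordinate_scal by auto.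
  replace (fun n p => c (u (S n) p)) with (fun n p => a * c (curl (v n) p)).
  2: { apply functional_extensionality; intros n; rewrite Huv.
       apply functional_extensionality; intros q; now rewrite coordinate_scal. }
  unfold curl; rewrite !P by auto.
  destruct Hc as [<-|[<-|[<-|[]]]]; symmetry.
  - exact (generating_series_scal_minus _ _ a (p, theta)
      (W cz e_y In_cz In_e_y) (W cy e_z In_cy In_e_z)).
  - exact (generating_series_scal_minus _ _ a (p, theta)
      (W cx e_z In_cx In_e_z) (W cz e_x In_cz In_e_x)).
  - exact (generating_series_scal_minus _ _ a (p, theta)
      (W cy e_x In_cy In_e_x) (W cx e_y In_cx In_e_y)). }
rewrite E.
apply is_derive_ext with (2 := generating_series_time_derivative _ p theta
  (proj2 (proj2 (Hu c Hc)))).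
intros t; now rewrite coordinate_generating_field.
Qed.

Lemma generating_field_initial u p : generating_field u (p, 0) = u 0%nat p.
Proof.
apply R3_ext; intros c Hc; rewrite coordinate_generating_field by auto.
unfold generating_series; simpl fst; simpl snd; rewrite PSeries_0; simpl; field.
Qed.

Theorem theorem3 (epsilon mu eta : R) (Fh Fe : R3 -> R3)
  (epsilon_pos : 0 < epsilon) (mu_pos : 0 < mu)
  (eta_def : eta = sqrt (mu / epsilon))
  (Fh_smooth : smooth basis3 Fh) (Fe_smooth : smooth basis3 Fe)
  (Fh_div : forall p, divergence Fh p = 0)
  (Fe_div : forall p, divergence Fe p = 0)
  (growth : exists C A beta : R, 0 < C /\ 0 < A /\ 0 <= beta < 1 /\
     curl_growth C A beta Fh /\ curl_growth C A beta Fe) :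
  (converges_absolutely (even_terms Fh) /\
   converges_absolutely (odd_terms_H Fe) /\
   converges_absolutely (even_terms Fe) /\
   converges_absolutely (odd_terms_E Fh)) /\
  (converges_uniformly_on_compacts (even_terms Fh) /\
   converges_uniformly_on_compacts (odd_terms_H Fe) /\
   converges_uniformly_on_compacts (even_terms Fe) /\
   converges_uniformly_on_compacts (odd_terms_E Fh)) /\
  maxwell_ivp eta Fh Fe (field_H eta Fh Fe) (field_E eta Fh Fe).
Proof.
destruct growth as (C & A & beta & HC & HA & [_ Hbeta] & Gh & Ge).
assert (Heta : 0 < eta) by (rewrite eta_def; now apply sqrt_lt_R0, Rdiv_lt_0_compat).
assert (T1 := curl_terms_converge (fun n => n + 1)%nat (fun n => 2 * (n + 1))%nat C A beta Fh
  ltac:(cbv beta; intros; lia) HC HA Hbeta Gh).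
assert (T2 := curl_terms_converge (fun n => n + 1)%nat (fun n => 2 * n + 1)%nat C A beta Fe
  ltac:(cbv beta; intros; lia) HC HA Hbeta Ge).
assert (T3 := curl_terms_converge (fun n => n + 1)%nat (fun n => 2 * (n + 1))%nat C A beta Fe
  ltac:(cbv beta; intros; lia) HC HA Hbeta Ge).
assert (T4 := curl_terms_converge (fun n => n)%nat (fun n => 2 * n + 1)%nat C A beta Fh
  ltac:(cbv beta; intros; lia) HC HA Hbeta Gh).
split; [repeat split; [apply T1|apply T2|apply T3|apply T4]|].
split; [repeat split; [apply T1|apply T2|apply T3|apply T4]|].
clear T1 T2 T3 T4.
(* With [a] and [eta] exchanged along with the two fields, the equations for [E] are
   those for [H]. *)
set (a := - (1 / eta)).
assert (Hab : a * eta = -1) by (unfold a; field; lra).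
assert (Hba : eta * a = -1) by (rewrite Rmult_comm; exact Hab).
set (h := maxwell_coeff a eta Fh Fe); set (e := maxwell_coeff eta a Fe Fh).
assert (Wh : forall c, In c coordinates -> wave_family (fun n p => c (h n p))).
{ intros c Hc; now apply (maxwell_coeff_wave_family a eta C A beta). }
assert (We : forall c, In c coordinates -> wave_family (fun n p => c (e n p))).
{ intros c Hc; now apply (maxwell_coeff_wave_family eta a C A beta). }
assert (HE : field_E eta Fh Fe = generating_field e).
{ apply functional_extensionality; intros [p theta]; apply even_odd_expansion; auto.
  intros c Hc; now apply We. }
assert (HH : field_H eta Fh Fe = generating_field h).
{ apply functional_extensionality; intros [p theta].
  unfold h; rewrite <- even_odd_expansion by (auto; intros; now apply Wh).
  unfold field_H; f_equal.
  apply R3_ext; intros c Hc; rewrite !coordinate_scal, !coordinate_vsum by auto.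
  unfold a; rewrite Ropp_mult_distr_l_reverse, Ropp_mult_distr_r, <- Series_opp; f_equal.
  apply Series_ext; intros n; unfold odd_terms_H, odd_terms_E, curl_term.
  rewrite !coordinate_scal by auto; rewrite pow_add; ring. }
assert (Sm : forall u, (forall c, In c coordinates -> wave_family (fun n p => c (u n p))) ->
  smooth basis4 (generating_field u)).
{ intros u Hu; apply smooth_coordinates; intros c Hc.
  assert (Hs := wave_family_smooth _ (Hu c Hc)).
  destruct Hc as [<-|[<-|[<-|[]]]]; exact Hs. }
rewrite HE, HH.
refine (conj (Sm _ Wh) (conj (Sm _ We) (conj _ (conj _ (conj _ _))))).
- intros p theta; now apply generating_field_evolution.
- intros p theta; now apply generating_field_evolution.
- intros p; apply generating_field_initial.
- intros p; apply generating_field_initial.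
Qed.
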